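(* Let $\mathcal{X}$ be a real or complex Banach space and let $L_0\in\mathcal{B}(\mathcal{X})$ have a simple isolated eigenvalue $\lambda_0$, with condition number $\tau_0:=\tau_{L_0}$ and spectral isolation $\gamma_0:=\gamma_{L_0}$. Then every $L\in\mathcal{B}(\mathcal{X})$ with $\|L-L_0\|<\frac{1}{6\tau_0\gamma_0}$ has an ASIE. More precisely, there is an analytic map $L\mapsto\lambda_L$ on the open ball $B\big(L_0,\frac{1}{6\tau_0\gamma_0}\big)\subset\mathcal{B}(\mathcal{X})$ with $\lambda_{L_0}=\lambda_0$ such that $\lambda_L$ is a simple isolated eigenvalue of $L$ for every $L$ in this ball.
   Context: $\mathcal{X}$ is a real or complex Banach space with scalar field $\mathbb{K}$. $\mathcal{B}(\mathcal{X})$ denotes the bounded linear operators on $\mathcal{X}$ with the operator norm. $\mathcal{X}^*$ consists of the bounded linear (not semilinear) forms. An operator $L$ has $\lambda\in\mathbb{K}$ as a simple isolated eigenvalue if there are a nonzero $u\in\mathcal{X}$ with $Lu=\lambda u$ and a closed complement $G$ of $\langle u\rangle$ with $L(G)\subset G$ such that $(L-\lambda)|_G:G\to G$ is invertible with bounded inverse. In that case there is an eigenform $\phi\in\mathcal{X}^*$ with $\phi\circ L=\lambda\phi$ and $\ker\phi=G$; normalize it so that $\phi(u)=1$. Set $P_L=\phi(\cdot)u$ (the rank-one operator $x\mapsto\phi(x)u$), $\pi_L=\mathrm{Id}-P_L$, and define the reduced resolvent $S_L=(L-\lambda)|_G^{-1}\circ\pi_L\in\mathcal{B}(\mathcal{X})$.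 The condition number is $\tau_L=\frac{\|\phi\|\|u\|}{|\phi(u)|}=\|P_L\|$ and the spectral isolation is $\gamma_L=\|S_L\|$. Every $L$ in an open connected set $\mathcal{V}\ni L_0$ is said to have an ASIE (analytic simple isolated eigenvalue) if there is an analytic map $\lambda:\mathcal{V}\to\mathbb{K}$ (analytic in the sense of locally convergent power series of bounded symmetric multilinear maps) with $\lambda_{L_0}=\lambda_0$ such that $\lambda_L$ is a simple isolated eigenvalue of $L$ for every $L\in\mathcal{V}$. *)

(* Defs.v *)
From Stdlib Require Import Reals ClassicalEpsilon.
Open Scope R_scope.
Set Implicit Arguments.

Record Scalars := {
  scal_car :> Type;
  k0 : scal_car; k1 : scal_car;
  kadd : scal_car -> scal_car -> scal_car;
  kmul : scal_car -> scal_car -> scal_car;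
  kopp : scal_car -> scal_car;
  kabs : scal_car -> R }.
Arguments k0 {s}. Arguments k1 {s}. Arguments kadd {s}. Arguments kmul {s}.
Arguments kopp {s}. Arguments kabs {s}.

Definition RK : Scalars :=
  {| scal_car := R; k0 := 0; k1 := 1; kadd := Rplus; kmul := Rmult;
     kopp := Ropp; kabs := Rabs |}.

Definition CK : Scalars :=
  {| scal_car := (R * R)%type; k0 := (0, 0); k1 := (1, 0);
     kadd := fun z w => (fst z + fst w, snd z + snd w);
     kmul := fun z w => (fst z * fst w - snd z * snd w, fst z * snd w + snd z * fst w);
     kopp := fun z => (- fst z, - snd z);
     kabs := fun z => sqrt (fst z * fst z + snd z * snd z) |}.

Record Banach (K : Scalars) := {
  vcar :> Type;
  vzero : vcar;
  vadd : vcar -> vcar -> vcar;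
  vopp : vcar -> vcar;
  vscal : K -> vcar -> vcar;
  vnorm : vcar -> R;
  ax_add_assoc : forall x y z, vadd x (vadd y z) = vadd (vadd x y) z;
  ax_add_comm : forall x y, vadd x y = vadd y x;
  ax_add_0 : forall x, vadd x vzero = x;
  ax_add_opp : forall x, vadd x (vopp x) = vzero;
  ax_scal_1 : forall x, vscal k1 x = x;
  ax_scal_assoc : forall a b x, vscal a (vscal b x) = vscal (kmul a b) x;
  ax_scal_distr_v : forall a x y, vscal a (vadd x y) = vadd (vscal a x) (vscal a y);
  ax_scal_distr_k : forall a b x, vscal (kadd a b) x = vadd (vscal a x) (vscal b x);
  ax_norm_eq0 : forall x, vnorm x = 0 -> x = vzero;
  ax_norm_scal : forall a x, vnorm (vscal a x) = kabs a * vnorm x;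
  ax_norm_triangle : forall x y, vnorm (vadd x y) <= vnorm x + vnorm y;
  ax_complete : forall u : nat -> vcar,
    (forall eps, 0 < eps -> exists N, forall m n, (N <= m)%nat -> (N <= n)%nat ->
        vnorm (vadd (u m) (vopp (u n))) < eps) ->
    exists l, forall eps, 0 < eps -> exists N, forall n, (N <= n)%nat ->
        vnorm (vadd (u n) (vopp l)) < eps }.
Arguments vzero {K b0} : rename. Arguments vadd {K b0} : rename. Arguments vopp {K b0} : rename.
Arguments vscal {K b0} : rename. Arguments vnorm {K b0} : rename.

Section Ops.
Context {K : Scalars} {X : Banach K}.

Definition vsub (x y : X) : X := vadd x (vopp y).

Definition is_linear (T : X -> X) : Prop :=
  (forall x y, T (vadd x y) = vadd (T x) (T y)) /\
  (forall a x, T (vscal a x) = vscal a (T x)).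
Definition is_bounded (T : X -> X) : Prop :=
  exists C, forall x, vnorm (T x) <= C * vnorm x.
Definition BL (T : X -> X) : Prop := is_linear T /\ is_bounded T.

Definition opnorm (T : X -> X) : R :=
  epsilon (inhabits 0)
    (fun c => is_lub (fun r => exists x, vnorm x <= 1 /\ r = vnorm (T x)) c).

Definition opadd (S T : X -> X) : X -> X := fun x => vadd (S x) (T x).
Definition opsub (S T : X -> X) : X -> X := fun x => vsub (S x) (T x).
Definition opscal (a : K) (T : X -> X) : X -> X := fun x => vscal a (T x).
Definition shift (L : X -> X) (lam : K) : X -> X := fun x => vsub (L x) (vscal lam x).

Definition is_linear_form (phi : X -> K) : Prop :=
  (forall x y, phi (vadd x y) = kadd (phi x) (phi y)) /\
  (forall a x, phi (vscal a x) = kmul a (phi x)).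
Definition is_bounded_form (phi : X -> K) : Prop :=
  exists C, forall x, kabs (phi x) <= C * vnorm x.

Definition closed_subspace (G : X -> Prop) : Prop :=
  G vzero /\ (forall x y, G x -> G y -> G (vadd x y)) /\
  (forall a x, G x -> G (vscal a x)) /\
  (forall (s : nat -> X) l, (forall n, G (s n)) ->
     (forall eps, 0 < eps -> exists N, forall n, (N <= n)%nat -> vnorm (vsub (s n) l) < eps) ->
     G l).

Definition complement_of_line (u : X) (G : X -> Prop) : Prop :=
  (forall x, exists a g, G g /\ x = vadd (vscal a u) g) /\
  (forall a, G (vscal a u) -> vscal a u = vzero).

Definition SIE_data (L : X -> X) (lam : K) (u : X) (G : X -> Prop) (Rinv : X -> X) : Prop :=
  u <> vzero /\ L u = vscal lam u /\ closed_subspace G /\ complement_of_line u G /\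
  (forall g, G g -> G (L g)) /\
  (forall g, G g -> G (Rinv g)) /\
  (forall g, G g -> Rinv (shift L lam g) = g) /\
  (forall g, G g -> shift L lam (Rinv g) = g) /\
  (exists C, forall g, G g -> vnorm (Rinv g) <= C * vnorm g).

Definition simple_isolated_eigenvalue (L : X -> X) (lam : K) : Prop :=
  exists u G Rinv, SIE_data L lam u G Rinv.

(* P_L = phi(.) u, and S_L = (L - lam)|_G^{-1} o (Id - P_L) *)
Definition Pop (phi : X -> K) (u : X) : X -> X := fun x => vscal (phi x) u.
Definition Sop (phi : X -> K) (u : X) (Rinv : X -> X) : X -> X :=
  fun x => Rinv (vsub x (vscal (phi x) u)).

Fixpoint ksum (f : nat -> K) (n : nat) : K :=
  match n with O => f O | S m => kadd (ksum f m) (f (S m)) end.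
Definition kseries_conv (f : nat -> K) (l : K) : Prop :=
  forall eps, 0 < eps -> exists N, forall n, (N <= n)%nat ->
    kabs (kadd (ksum f n) (kopp l)) < eps.

Fixpoint rprod (f : nat -> R) (n : nat) : R :=
  match n with O => 1 | S m => rprod f m * f m end.

Definition update (h : nat -> X -> X) (i : nat) (T : X -> X) : nat -> X -> X :=
  fun j => if Nat.eqb j i then T else h j.

(* An is a bounded symmetric n-linear form on B(X) (arguments h 0, ..., h (n-1)) *)
Definition bdd_sym_multilinear (n : nat) (An : (nat -> X -> X) -> K) : Prop :=
  (forall h h', (forall i, (i < n)%nat -> h i = h' i) -> An h = An h') /\
  (forall h i a S T, (forall j, BL (h j)) -> BL S -> BL T -> (i < n)%nat ->
     An (update h i (opadd (opscal a S) T)) =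
     kadd (kmul a (An (update h i S))) (An (update h i T))) /\
  (forall h (sigma : nat -> nat), (forall j, BL (h j)) ->
     (forall i, (i < n)%nat -> (sigma i < n)%nat) ->
     (forall i j, (i < n)%nat -> (j < n)%nat -> sigma i = sigma j -> i = j) ->
     An (fun i => h (sigma i)) = An h) /\
  (exists C, forall h, (forall j, BL (h j)) ->
     kabs (An h) <= C * rprod (fun i => opnorm (h i)) n).

Definition analytic_on (U : (X -> X) -> Prop) (f : (X -> X) -> K) : Prop :=
  forall L1, BL L1 -> U L1 ->
  exists (A : nat -> (nat -> X -> X) -> K) (M : nat -> R) (r : R),
    0 < r /\
    (forall n, bdd_sym_multilinear n (A n)) /\
    (forall n h, (forall j, BL (h j)) ->
        kabs (A n h) <= M n * rprod (fun i => opnorm (h i)) n) /\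
    (exists s, Un_cv (fun N => sum_f_R0 (fun n => M n * r ^ n) N) s) /\
    (forall L, BL L -> U L -> opnorm (opsub L L1) < r ->
        kseries_conv (fun n => A n (fun _ => opsub L L1)) (f L)).

End Ops.

(* Main.v *)
Require Import Defs.
From Stdlib Require Import Reals Lra Lia Ring ClassicalEpsilon FunctionalExtensionality.
From Stdlib Require Import Arith List Permutation ListDec.
Import ListNotations.
Open Scope R_scope.

(* Put E = L - L0. A vector u + v with v in G is an eigenvector of L iff
   v = S (phi (E (u + v)) v - E (u + v)), with eigenvalue lam0 + phi (E (u + v)). For
   6 tau gamma ||E|| < 1 the right-hand side is a 1/2-contraction of the ball
   ||phi|| ||v|| <= 1/2. On u_L = u + v and G the operator L is block triangular, and its
   compression to G minus the eigenvalue is (L0 - lam0)(1 + T) with ||T|| <= 1/2, hence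
   invertible; this yields the eigenform and the reduced resolvent of L.
   Analyticity at L1 uses the eigendata of L1 itself: the fixed point equation for L - L1 is
   solved by a power series whose coefficients obey a Catalan-type recursion, and the
   eigenvector of L so obtained is not in the kernel of the eigenform of L, so it belongs to
   the same eigenvalue. *)

(** * Permutations of index sets *)

Fixpoint words (n m : nat) : list (list nat) :=
  match m with
  | O => [[]]
  | S m => flat_map (fun t => map (fun i => i :: t) (seq 0 n)) (words n m)
  end.

Lemma in_words n m t :
  In t (words n m) <-> length t = m /\ forall i, In i t -> (i < n)%nat.
Proof.
revert t; induction m as [|m IH]; intros t; simpl.
- split.
  + intros [<- | []]. simpl. split; [reflexivity | intros i []].
  + intros [H _]. destruct t; [auto | discriminate].
- rewrite in_flat_map. split.
  + intros [s [Hs Ht]]. apply in_map_iff in Ht. destruct Ht as [i [<- Hi]].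
    apply in_seq in Hi. apply IH in Hs. destruct Hs as [H1 H2]. simpl. split; [lia|].
    intros j [<- | Hj]; [lia | auto].
  + intros [H1 H2]. destruct t as [|i t]; [discriminate|]. exists t. split.
    * apply IH. simpl in H1. split; [lia | intros; apply H2; now right].
    * apply in_map_iff. exists i. split; [reflexivity|]. apply in_seq.
      pose proof (H2 i (or_introl eq_refl)). lia.
Qed.

(* A permutation of {0, ..., n-1} is encoded as its list of values. *)
Definition index_perms (n : nat) : list (list nat) :=
  nodup (list_eq_dec Nat.eq_dec)
    (filter (fun t => if ListDec.NoDup_dec Nat.eq_dec t then true else false) (words n n)).

Lemma in_index_perms n t : In t (index_perms n) <->
  NoDup t /\ length t = n /\ forall i, In i t -> (i < n)%nat.
Proof.
unfold index_perms. rewrite nodup_In, filter_In, in_words.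
destruct (ListDec.NoDup_dec Nat.eq_dec t) as [H | H]; split; intros H'.
- tauto.
- tauto.
- destruct H'; discriminate.
- tauto.
Qed.

Lemma index_perm_Permutation n t : In t (index_perms n) -> Permutation t (seq 0 n).
Proof.
intros H. apply in_index_perms in H. destruct H as [H1 [H2 H3]].
apply NoDup_Permutation_bis; trivial.
- rewrite length_seq. lia.
- intros i Hi. apply in_seq. apply H3 in Hi. lia.
Qed.

Lemma index_perms_pos n : 0 < INR (length (index_perms n)).
Proof.
apply lt_0_INR.
assert (H : In (seq 0 n) (index_perms n)).
{ apply in_index_perms. rewrite length_seq. split; [apply seq_NoDup | split; [reflexivity|]].
  intros i Hi. apply in_seq in Hi. lia. }
destruct (index_perms n); [destruct H | simpl; lia].
Qed.

Lemma index_perm_nth_lt n t i : In t (index_perms n) -> (i < n)%nat -> (nth i t O < n)%nat.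
Proof. intros H Hi. apply in_index_perms in H. apply H, nth_In. lia. Qed.

Lemma index_perm_inj n t i j : In t (index_perms n) -> (i < n)%nat -> (j < n)%nat ->
  nth i t O = nth j t O -> i = j.
Proof.
intros H Hi Hj E. apply in_index_perms in H. destruct H as [H1 [H2 _]].
apply (proj1 (NoDup_nth t O) H1); lia.
Qed.

Lemma index_perm_surj n t i : In t (index_perms n) -> (i < n)%nat ->
  exists k, (k < n)%nat /\ nth k t O = i.
Proof.
intros H Hi. destruct (In_nth t i O) as [k [Hk E]].
- apply (Permutation_in _ (Permutation_sym (index_perm_Permutation n t H))).
  apply in_seq. lia.
- apply in_index_perms in H. exists k. split; [lia | assumption].
Qed.

Lemma index_perms_compose n (sigma : nat -> nat) :
  (forall i, (i < n)%nat -> (sigma i < n)%nat) ->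
  (forall i j, (i < n)%nat -> (j < n)%nat -> sigma i = sigma j -> i = j) ->
  Permutation (map (map sigma) (index_perms n)) (index_perms n).
Proof.
intros Hs Hi.
assert (inj_map : forall t t', (forall i, In i t -> (i < n)%nat) ->
  (forall i, In i t' -> (i < n)%nat) -> map sigma t = map sigma t' -> t = t').
{ induction t as [|i t IH]; intros [|i' t'] H H' E; try discriminate; trivial.
  injection E as E1 E2. f_equal.
  - apply Hi; [apply H | apply H' | exact E1]; now left.
  - apply IH; trivial; intros; [apply H | apply H']; now right. }
apply NoDup_Permutation_bis.
- apply NoDup_map_NoDup_ForallPairs; [|apply NoDup_nodup].
  intros t t' Ht Ht' E. apply in_index_perms in Ht, Ht'. apply inj_map; tauto.
- now rewrite length_map.
- intros s H. apply in_map_iff in H. destruct H as [t [<- Ht]].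
  apply in_index_perms in Ht. destruct Ht as [H1 [H2 H3]].
  apply in_index_perms. split; [|split].
  + apply NoDup_map_NoDup_ForallPairs; [|assumption]. intros i j Hi' Hj'. apply Hi; auto.
  + now rewrite length_map.
  + intros i H. apply in_map_iff in H. destruct H as [j [<- Hj]]. auto.
Qed.

Lemma rprod_ext (f g : nat -> R) n : (forall i, (i < n)%nat -> f i = g i) -> rprod f n = rprod g n.
Proof. induction n as [|n IH]; simpl; intros H; [reflexivity | rewrite H, IH; auto]. Qed.

Lemma rprod_add (f : nat -> R) a b :
  rprod f (a + b) = rprod f a * rprod (fun j => f (a + j)%nat) b.
Proof.
induction b as [|b IH]; simpl.
- rewrite Nat.add_0_r. ring.
- rewrite Nat.add_succ_r. simpl. rewrite IH. ring.
Qed.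

Lemma rprod_const c n : rprod (fun _ => c) n = c ^ n.
Proof. induction n as [|n IH]; simpl; [|rewrite IH]; ring. Qed.

Lemma rprod_ge0 (f : nat -> R) n : (forall i, 0 <= f i) -> 0 <= rprod f n.
Proof. intros H; induction n; simpl; [lra | now apply Rmult_le_pos]. Qed.

Lemma rprod_list (f : nat -> R) t :
  rprod (fun j => f (nth j t O)) (length t) = fold_right Rmult 1 (map f t).
Proof.
induction t as [|i t IH]; [reflexivity|].
change (length (i :: t)) with (1 + length t)%nat. rewrite rprod_add. simpl.
rewrite <- IH. ring.
Qed.

Lemma rprod_index_perm n t (f : nat -> R) : In t (index_perms n) ->
  rprod (fun j => f (nth j t O)) n = rprod f n.
Proof.
intros H. assert (Hl : length t = n) by now apply in_index_perms in H.
rewrite <- Hl at 1. rewrite rprod_list.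
transitivity (fold_right Rmult 1 (map f (seq 0 n))).
- assert (HP := Permutation_map f (index_perm_Permutation n t H)).
  induction HP; simpl; try congruence. ring.
- rewrite <- rprod_list, length_seq. apply rprod_ext. intros i Hi. now rewrite seq_nth.
Qed.

(** * Scalars and Banach spaces *)

Definition ksub {K : Scalars} (a b : K) : K := kadd a (kopp b).

Definition kofR {K : Scalars} (HK : K = RK \/ K = CK) : {f : R -> K |
    (forall x y, f (x + y) = kadd (f x) (f y)) /\
    (forall x y, f (x * y) = kmul (f x) (f y)) /\
    f 1 = k1 /\ (forall x, kabs (f x) = Rabs x)}.
Proof.
apply constructive_indefinite_description.
destruct HK as [-> | ->].
- exists (fun x => x); simpl; auto.
- exists (fun x => (x, 0)); simpl; repeat split; intros; try (f_equal; ring).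
  replace (x * x + 0 * 0) with (Rsqr x) by (unfold Rsqr; ring).
  apply sqrt_Rsqr_abs.
Qed.

Section Scalars.
Context {K : Scalars} (HK : K = RK \/ K = CK).

Lemma scalars_ring_theory :
  ring_theory (R := K) k0 k1 kadd kmul ksub kopp (@eq K).
Proof.
destruct HK as [-> | ->].
- constructor; simpl; unfold ksub; simpl; intros; ring.
- constructor; simpl; unfold ksub; simpl; intros;
    repeat match goal with x : (R * R)%type |- _ => destruct x end; simpl; f_equal; ring.
Qed.

Lemma kabs_mul (a b : K) : kabs (kmul a b) = kabs a * kabs b.
Proof.
destruct HK as [-> | ->]; simpl in *.
- apply Rabs_mult.
- destruct a as [a a'], b as [b b']; simpl in *.
  rewrite <- sqrt_mult; [f_equal; ring | nra | nra].
Qed.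

Lemma kabs_ge0 (a : K) : 0 <= kabs a.
Proof. destruct HK as [-> | ->]; simpl in *; [apply Rabs_pos | apply sqrt_pos]. Qed.

Lemma kabs_eq0 (a : K) : kabs a = 0 -> a = k0.
Proof.
destruct HK as [-> | ->]; simpl in *.
- intros H; destruct (Req_dec a 0) as [|H']; [assumption|].
  exfalso; now apply (Rabs_no_R0 _ H').
- destruct a as [a a']; simpl in *; intros H.
  apply sqrt_eq_0 in H; [|nra]. f_equal; nra.
Qed.

Lemma kabs_triangle (a b : K) : kabs (kadd a b) <= kabs a + kabs b.
Proof.
destruct HK as [-> | ->]; simpl in *.
- apply Rabs_triang.
- destruct a as [a a'], b as [b b']; simpl in *.
  pose proof (sqrt_pos (a * a + a' * a')) as H1.
  pose proof (sqrt_pos (b * b + b' * b')) as H2.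
  assert (E1 := sqrt_sqrt (a * a + a' * a') ltac:(nra)).
  assert (E2 := sqrt_sqrt (b * b + b' * b') ltac:(nra)).
  set (s := sqrt (a * a + a' * a')) in *; set (t := sqrt (b * b + b' * b')) in *.
  rewrite <- (sqrt_square (s + t)) by lra.
  apply sqrt_le_1_alt.
  assert (a * b + a' * b' <= s * t); [|nra].
  apply Rsqr_incr_0_var; [|nra]. unfold Rsqr.
  replace (s * t * (s * t)) with ((s * s) * (t * t)) by ring.
  rewrite E1, E2. pose proof (pow2_ge_0 (a * b' - a' * b)). nra.
Qed.

Lemma kabs_1 : kabs (@k1 K) = 1.
Proof.
destruct HK as [-> | ->]; simpl.
- apply Rabs_R1.
- replace (1 * 1 + 0 * 0) with 1 by ring. apply sqrt_1.
Qed.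

Lemma kabs_0 : kabs (@k0 K) = 0.
Proof.
destruct HK as [-> | ->]; simpl.
- apply Rabs_R0.
- replace (0 * 0 + 0 * 0) with 0 by ring. apply sqrt_0.
Qed.

Lemma k1_neq0 : @k1 K <> k0.
Proof. intros H. pose proof kabs_1. rewrite H, kabs_0 in H0. lra. Qed.

Lemma kabs_opp (a : K) : kabs (kopp a) = kabs a.
Proof.
destruct HK as [-> | ->]; simpl in *.
- apply Rabs_Ropp.
- f_equal; ring.
Qed.

Lemma kabs_sub (a b : K) : kabs (ksub a b) <= kabs a + kabs b.
Proof. unfold ksub. rewrite <- (kabs_opp b). apply kabs_triangle. Qed.

Lemma kmul_integral (a b : K) : kmul a b = k0 -> a = k0 \/ b = k0.
Proof.
intros H. assert (H0 : kabs a * kabs b = 0) by now rewrite <- kabs_mul, H, kabs_0.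
apply Rmult_integral in H0. destruct H0; [left | right]; now apply kabs_eq0.
Qed.

End Scalars.

Section Space.
Context {K : Scalars} (HK : K = RK \/ K = CK) {X : Banach K}.

Add Ring K_ring : (scalars_ring_theory HK).

Lemma vadd_0l (x : X) : vadd vzero x = x.
Proof. now rewrite ax_add_comm, ax_add_0. Qed.

Lemma vadd_cancel (x y z : X) : vadd x z = vadd y z -> x = y.
Proof.
intros H. rewrite <- (ax_add_0 _ x), <- (ax_add_0 _ y), <- (ax_add_opp _ z).
now rewrite !ax_add_assoc, H.
Qed.

Lemma vscal_k0 (x : X) : vscal k0 x = vzero.
Proof.
apply (vadd_cancel _ _ (vscal k0 x)). rewrite <- ax_scal_distr_k, vadd_0l.
f_equal. ring.
Qed.

Lemma vscal_vzero (a : K) : vscal a (@vzero K X) = vzero.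
Proof.
apply (vadd_cancel _ _ (vscal a vzero)). now rewrite <- ax_scal_distr_v, !vadd_0l.
Qed.

(* The square-zero extension K + X: [ring] in it decides linear identities in X. *)
Definition sqz : Type := (K * X)%type.
Definition sz0 : sqz := (k0, vzero).
Definition sz1 : sqz := (k1, vzero).
Definition szadd (a b : sqz) : sqz := (kadd (fst a) (fst b), vadd (snd a) (snd b)).
Definition szmul (a b : sqz) : sqz :=
  (kmul (fst a) (fst b), vadd (vscal (fst a) (snd b)) (vscal (fst b) (snd a))).
Definition szopp (a : sqz) : sqz := (kopp (fst a), vopp (snd a)).
Definition szsub (a b : sqz) : sqz := szadd a (szopp b).

Lemma sqz_ring_theory : ring_theory sz0 sz1 szadd szmul szsub szopp eq.
Proof.
assert (A4 : forall a b c d : X,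
  vadd (vadd a b) (vadd c d) = vadd (vadd a c) (vadd b d)).
{ intros a b c d. rewrite <- !ax_add_assoc. f_equal.
  rewrite !ax_add_assoc. f_equal. apply ax_add_comm. }
constructor; unfold sz0, sz1, szadd, szmul, szopp, szsub; simpl; intros;
  repeat match goal with x : sqz |- _ => destruct x end; simpl; f_equal; try ring.
- apply vadd_0l.
- apply ax_add_comm.
- apply ax_add_assoc.
- now rewrite ax_scal_1, vscal_vzero, ax_add_0.
- apply ax_add_comm.
- rewrite !ax_scal_distr_v, !ax_scal_assoc, <- !ax_add_assoc. f_equal.
  f_equal; f_equal; ring.
- rewrite ax_scal_distr_v, ax_scal_distr_k. apply A4.
- reflexivity.
- apply ax_add_opp.
Qed.

Add Ring sqz_ring : sqz_ring_theory.

Definition inX (x : X) : sqz := (k0, x).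
Definition inK (a : K) : sqz := (a, vzero).

Lemma inX_inj (x y : X) : inX x = inX y -> x = y.
Proof. unfold inX. congruence. Qed.
Lemma inX_0 : inX vzero = sz0. Proof. reflexivity. Qed.
Lemma inX_add (x y : X) : inX (vadd x y) = szadd (inX x) (inX y).
Proof. unfold inX, szadd; simpl; f_equal; ring. Qed.
Lemma inX_opp (x : X) : inX (vopp x) = szopp (inX x).
Proof. unfold inX, szopp; simpl; f_equal; ring. Qed.
Lemma inX_scal (a : K) (x : X) : inX (vscal a x) = szmul (inK a) (inX x).
Proof.
unfold inX, inK, szmul; simpl. rewrite vscal_vzero, ax_add_0. f_equal; ring.
Qed.
Lemma inK_0 : inK k0 = sz0. Proof. reflexivity. Qed.
Lemma inK_1 : inK k1 = sz1. Proof. reflexivity. Qed.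
Lemma inK_add (a b : K) : inK (kadd a b) = szadd (inK a) (inK b).
Proof. unfold inK, szadd; simpl. now rewrite ax_add_0. Qed.
Lemma inK_mul (a b : K) : inK (kmul a b) = szmul (inK a) (inK b).
Proof. unfold inK, szmul; simpl. now rewrite !vscal_vzero, ax_add_0. Qed.
Lemma inK_opp (a : K) : inK (kopp a) = szopp (inK a).
Proof.
unfold inK, szopp; simpl. f_equal. rewrite <- (ax_add_opp _ (@vzero K X)) at 1. apply vadd_0l.
Qed.

Ltac vec := apply inX_inj; unfold vsub, ksub;
  repeat (rewrite inX_add || rewrite inX_opp || rewrite inX_scal || rewrite inX_0
    || rewrite inK_0 || rewrite inK_1 || rewrite inK_add || rewrite inK_mul || rewrite inK_opp);
  ring.

Lemma vsub_eq0 (x y : X) : vsub x y = vzero -> x = y.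
Proof. intros H. replace x with (vadd (vsub x y) y) by vec. rewrite H. vec. Qed.

Lemma vnorm_0 : vnorm (@vzero K X) = 0.
Proof. rewrite <- (vscal_k0 vzero), ax_norm_scal, (kabs_0 HK). ring. Qed.
Lemma vnorm_opp (x : X) : vnorm (vopp x) = vnorm x.
Proof.
replace (vopp x) with (vscal (kopp k1) x) by vec.
rewrite ax_norm_scal, (kabs_opp HK), (kabs_1 HK). ring.
Qed.
Lemma vnorm_ge0 (x : X) : 0 <= vnorm x.
Proof.
pose proof (ax_norm_triangle _ x (vopp x)) as H.
rewrite ax_add_opp, vnorm_0, vnorm_opp in H. lra.
Qed.
Lemma vnorm_sub (x y : X) : vnorm (vsub x y) <= vnorm x + vnorm y.
Proof. rewrite <- (vnorm_opp y). apply ax_norm_triangle. Qed.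
Lemma vnorm_sub_sym (x y : X) : vnorm (vsub x y) = vnorm (vsub y x).
Proof. rewrite <- vnorm_opp. f_equal. vec. Qed.
Lemma vnorm_pos (x : X) : x <> vzero -> 0 < vnorm x.
Proof.
intros H. destruct (vnorm_ge0 x) as [|E]; [assumption|].
exfalso; apply H, ax_norm_eq0; congruence.
Qed.

Lemma lin_add (T : X -> X) x y : is_linear T -> T (vadd x y) = vadd (T x) (T y).
Proof. intros [H _]; apply H. Qed.
Lemma lin_scal (T : X -> X) a x : is_linear T -> T (vscal a x) = vscal a (T x).
Proof. intros [_ H]; apply H. Qed.
Lemma lin_0 (T : X -> X) : is_linear T -> T vzero = vzero.
Proof. intros H. rewrite <- (vscal_k0 vzero), (lin_scal T) by assumption. now rewrite !vscal_k0. Qed.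
Lemma lin_opp (T : X -> X) x : is_linear T -> T (vopp x) = vopp (T x).
Proof.
intros H. replace (vopp x) with (vscal (kopp k1) x) by vec. rewrite (lin_scal T) by assumption. vec.
Qed.
Lemma lin_sub (T : X -> X) x y : is_linear T -> T (vsub x y) = vsub (T x) (T y).
Proof. intros H. unfold vsub. now rewrite lin_add, lin_opp. Qed.

Lemma form_add (f : X -> K) x y : is_linear_form f -> f (vadd x y) = kadd (f x) (f y).
Proof. intros [H _]; apply H. Qed.
Lemma form_scal (f : X -> K) a x : is_linear_form f -> f (vscal a x) = kmul a (f x).
Proof. intros [_ H]; apply H. Qed.
Lemma form_0 (f : X -> K) : is_linear_form f -> f vzero = k0.
Proof. intros H. rewrite <- (vscal_k0 vzero), (form_scal f) by assumption. ring. Qed.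
Lemma form_opp (f : X -> K) x : is_linear_form f -> f (vopp x) = kopp (f x).
Proof.
intros H. replace (vopp x) with (vscal (kopp k1) x) by vec. rewrite (form_scal f) by assumption. ring.
Qed.
Lemma form_sub (f : X -> K) x y : is_linear_form f -> f (vsub x y) = ksub (f x) (f y).
Proof. intros H. unfold vsub. now rewrite form_add, form_opp. Qed.

Lemma bounded_pos (T : X -> X) : is_bounded T -> exists C, 0 < C /\ forall x, vnorm (T x) <= C * vnorm x.
Proof.
intros [C HC]. exists (Rabs C + 1). split; [pose proof (Rabs_pos C); lra|].
intros x. pose proof (HC x). pose proof (vnorm_ge0 x). pose proof (Rle_abs C). nra.
Qed.
Lemma bounded_form_pos (f : X -> K) :
  is_bounded_form f -> exists C, 0 < C /\ forall x, kabs (f x) <= C * vnorm x.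
Proof.
intros [C HC]. exists (Rabs C + 1). split; [pose proof (Rabs_pos C); lra|].
intros x. pose proof (HC x). pose proof (vnorm_ge0 x). pose proof (Rle_abs C). nra.
Qed.

Lemma opnorm_lub (T : X -> X) : is_bounded T ->
  is_lub (fun r => exists x, vnorm x <= 1 /\ r = vnorm (T x)) (opnorm T).
Proof.
intros HT. unfold opnorm. apply epsilon_spec.
destruct (bounded_pos T HT) as [C [HC H]].
destruct (completeness (fun r => exists x, vnorm x <= 1 /\ r = vnorm (T x))) as [m Hm].
- exists C. intros r [x [Hx ->]]. pose proof (H x). nra.
- exists (vnorm (T vzero)), vzero. rewrite vnorm_0. split; [lra | reflexivity].
- now exists m.
Qed.

Lemma opnorm_ge0 (T : X -> X) : is_bounded T -> 0 <= opnorm T.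
Proof.
intros HT. destruct (opnorm_lub T HT) as [H _].
apply Rle_trans with (vnorm (T vzero)); [apply vnorm_ge0|].
apply H. exists vzero. rewrite vnorm_0. split; [lra | reflexivity].
Qed.

Lemma opnorm_bound (T : X -> X) x : BL T -> vnorm (T x) <= opnorm T * vnorm x.
Proof.
intros [HL HT]. destruct (opnorm_lub T HT) as [H _].
destruct (vnorm_ge0 x) as [Hx | Hx].
- destruct (kofR HK) as [f [_ [fM [f1 fabs]]]].
  assert (Hi : 0 < / vnorm x) by now apply Rinv_0_lt_compat.
  assert (vnorm (vscal (f (/ vnorm x)) (T x)) <= opnorm T).
  { apply H. exists (vscal (f (/ vnorm x)) x).
    rewrite lin_scal, !ax_norm_scal, fabs, Rabs_right by (assumption || lra).
    split; [|reflexivity]. rewrite Rinv_l; lra. }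
  rewrite ax_norm_scal, fabs, Rabs_right in H0 by lra.
  apply (Rmult_le_compat_r (vnorm x)) in H0; [|lra].
  replace (/ vnorm x * vnorm (T x) * vnorm x) with (vnorm (T x)) in H0; [assumption|].
  field. lra.
- symmetry in Hx. rewrite Hx, (ax_norm_eq0 _ x Hx), lin_0, vnorm_0 by assumption. lra.
Qed.

Lemma BL_sub (S T : X -> X) : BL S -> BL T -> BL (opsub S T).
Proof.
intros [HS BS] [HT BT]. split; [split|].
- intros x y. unfold opsub. rewrite !lin_add by assumption. vec.
- intros a x. unfold opsub. rewrite !lin_scal by assumption. vec.
- destruct BS as [C HC], BT as [D HD]. exists (C + D). intros x. unfold opsub.
  pose proof (vnorm_sub (S x) (T x)). pose proof (HC x). pose proof (HD x). lra.
Qed.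

Definition vcvg (s : nat -> X) (l : X) : Prop :=
  forall eps, 0 < eps -> exists N, forall n, (N <= n)%nat -> vnorm (vsub (s n) l) < eps.

Lemma pow_half_small (c eps : R) : 0 < eps -> exists N, forall n, (N <= n)%nat -> c * (/2)^n < eps.
Proof.
intros He. destruct (pow_lt_1_zero (/2) ltac:(rewrite Rabs_right; lra) (eps / (Rabs c + 1))) as [N HN].
{ apply Rdiv_lt_0_compat; [assumption | pose proof (Rabs_pos c); lra]. }
exists N. intros n Hn. specialize (HN n Hn).
assert (Hp : 0 < (/2)^n) by (apply pow_lt; lra).
rewrite Rabs_right in HN by lra.
pose proof (Rabs_pos c). pose proof (Rle_abs c).
apply (Rmult_lt_compat_r (Rabs c + 1)) in HN; [|lra].
unfold Rdiv in HN. rewrite Rmult_assoc, Rinv_l, Rmult_1_r in HN by lra. nra.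
Qed.

Lemma half_contraction_fixpoint (D : X -> Prop) (F : X -> X) (x0 : X) :
  D x0 -> (forall x, D x -> D (F x)) ->
  (forall s l, (forall n : nat, D (s n)) -> vcvg s l -> D l) ->
  (forall x y, D x -> D y -> vnorm (vsub (F x) (F y)) <= / 2 * vnorm (vsub x y)) ->
  exists x, D x /\ F x = x.
Proof.
intros H0 HF Hcl HL.
set (y := fun n => Nat.iter n F x0).
assert (Dy : forall n, D (y n)) by (induction n; simpl; auto).
set (d := vnorm (vsub (F x0) x0)).
assert (Hd : 0 <= d) by apply vnorm_ge0.
assert (H1 : forall n, vnorm (vsub (y (S n)) (y n)) <= d * (/2)^n).
{ induction n as [|n IH].
  - simpl. unfold d. lra.
  - change (y (S (S n))) with (F (y (S n))). change (y (S n)) with (F (y n)) at 2.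
    pose proof (HL _ _ (Dy (S n)) (Dy n)). simpl pow. lra. }
assert (H2 : forall n k, vnorm (vsub (y (n + k)%nat) (y n)) <= 2 * d * (/2)^n * (1 - (/2)^k)).
{ intros n k; induction k as [|k IH].
  - rewrite Nat.add_0_r. simpl. replace (vsub (y n) (y n)) with (@vzero K X) by vec.
    rewrite vnorm_0. lra.
  - rewrite Nat.add_succ_r.
    replace (vsub (y (S (n + k))) (y n)) with
      (vadd (vsub (y (S (n + k))) (y (n + k)%nat)) (vsub (y (n + k)%nat) (y n))) by vec.
    eapply Rle_trans; [apply ax_norm_triangle|].
    pose proof (H1 (n + k)%nat). rewrite pow_add in H. simpl pow.
    nra. }
assert (H3 : forall n k, vnorm (vsub (y (n + k)%nat) (y n)) <= 2 * d * (/2)^n).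
{ intros n k. pose proof (H2 n k).
  assert (0 < (/2)^k) by (apply pow_lt; lra).
  assert (0 < (/2)^n) by (apply pow_lt; lra).
  assert (0 <= 2 * d * (/2)^n) by nra. nra. }
destruct (ax_complete X y) as [l Hl].
{ intros eps He. destruct (pow_half_small (4 * d) eps He) as [N HN].
  exists N. intros m n Hm Hn.
  replace (vadd (y m) (vopp (y n))) with (vadd (vsub (y m) (y N)) (vopp (vsub (y n) (y N)))) by vec.
  eapply Rle_lt_trans; [apply ax_norm_triangle|]. rewrite vnorm_opp.
  pose proof (H3 N (m - N)%nat). pose proof (H3 N (n - N)%nat).
  replace (N + (m - N))%nat with m in * by lia. replace (N + (n - N))%nat with n in * by lia.
  pose proof (HN N (Nat.le_refl N)). lra. }
assert (Dl : D l) by (apply (Hcl y); assumption).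
exists l. split; [assumption|]. apply vsub_eq0, ax_norm_eq0.
destruct (vnorm_ge0 (vsub (F l) l)) as [Hp | Hp]; [exfalso | congruence].
destruct (Hl (vnorm (vsub (F l) l) / 2) ltac:(lra)) as [N HN].
pose proof (HN N ltac:(lia)) as A1. pose proof (HN (S N) ltac:(lia)) as A2.
pose proof (HL _ _ Dl (Dy N)) as A3.
change (y (S N)) with (F (y N)) in A2.
fold (vsub (y N) l) in A1. fold (vsub (F (y N)) l) in A2.
rewrite (vnorm_sub_sym l) in A3.
pose proof (ax_norm_triangle _ (vsub (F l) (F (y N))) (vsub (F (y N)) l)) as A4.
replace (vadd (vsub (F l) (F (y N))) (vsub (F (y N)) l)) with (vsub (F l) l) in A4 by vec.
lra.
Qed.

Lemma inverse_id_add (T : X -> X) :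
  is_linear T -> (forall x, vnorm (T x) <= / 2 * vnorm x) ->
  exists N : X -> X, is_linear N /\ (forall x, vnorm (N x) <= 2 * vnorm x) /\
    (forall x, vadd (N x) (T (N x)) = x) /\ (forall x, N (vadd x (T x)) = x).
Proof.
intros HT HB.
assert (inj : forall x y, vadd x (T x) = vadd y (T y) -> x = y).
{ intros x y H. apply vsub_eq0, ax_norm_eq0.
  assert (E : vsub x y = vopp (T (vsub x y))).
  { rewrite lin_sub by assumption.
    replace (vsub x y) with (vsub (vsub (vadd x (T x)) (T x)) (vsub (vadd y (T y)) (T y))) by vec.
    rewrite H. vec. }
  pose proof (HB (vsub x y)). pose proof (vnorm_ge0 (vsub x y)).
  apply (f_equal vnorm) in E. rewrite vnorm_opp in E. lra. }
assert (ex : forall x, exists y, vadd y (T y) = x).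
{ intros x.
  destruct (half_contraction_fixpoint (fun _ => True) (fun y => vsub x (T y)) vzero)
    as [y [_ Hy]]; auto.
  - intros y z _ _.
    replace (vsub (vsub x (T y)) (vsub x (T z))) with (T (vsub z y))
      by (rewrite lin_sub by assumption; vec).
    rewrite (vnorm_sub_sym y z). apply HB.
  - exists y. rewrite <- Hy at 1. vec. }
exists (fun x => epsilon (inhabits vzero) (fun y => vadd y (T y) = x)).
set (N := fun x => epsilon (inhabits vzero) (fun y => vadd y (T y) = x)).
assert (HN : forall x, vadd (N x) (T (N x)) = x) by (intros x; apply epsilon_spec, ex).
split; [split|split; [|split]].
- intros x y. apply inj. rewrite (HN (vadd x y)), lin_add by assumption.
  rewrite <- (HN x), <- (HN y) at 1. vec.
- intros a x. apply inj. rewrite (HN (vscal a x)), lin_scal by assumption.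
  rewrite <- (HN x) at 1. vec.
- intros x. pose proof (HB (N x)). fold (N x).
  assert (vnorm (N x) <= vnorm x + vnorm (T (N x))); [|lra].
  replace (N x) with (vsub (vadd (N x) (T (N x))) (T (N x))) at 1 by vec.
  rewrite HN. apply vnorm_sub.
- exact HN.
- intros x. apply inj. apply HN.
Qed.

(** * Perturbation of a simple isolated eigenvalue *)

Record eigen_data (L : X -> X) (lam : K) (u : X) (phi : X -> K) (S : X -> X) : Prop := {
  ed_op : BL L;
  ed_form : is_linear_form phi;
  ed_form_bounded : is_bounded_form phi;
  ed_res : BL S;
  ed_normalized : phi u = k1;
  ed_eigenvector : L u = vscal lam u;
  ed_eigenform : forall x, phi (L x) = kmul lam (phi x);
  ed_form_res : forall x, phi (S x) = k0;
  ed_res_shift : forall x, S (shift L lam x) = vsub x (vscal (phi x) u);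
  ed_shift_res : forall x, shift L lam (S x) = vsub x (vscal (phi x) u) }.

Lemma shift_linear L (lam : K) : is_linear L -> is_linear (shift L lam : X -> X).
Proof.
intros H; split; intros; unfold shift;
  [rewrite (lin_add L) | rewrite (lin_scal L)]; trivial; vec.
Qed.

Lemma ed_res_eigenvector {L lam u phi S} : eigen_data L lam u phi S -> S u = vzero.
Proof.
intros H. destruct (ed_res _ _ _ _ _ H) as [HS _].
assert (E : shift L lam (S u) = vzero).
{ rewrite (ed_shift_res _ _ _ _ _ H), (ed_normalized _ _ _ _ _ H). vec. }
pose proof (ed_res_shift _ _ _ _ _ H (S u)) as E2.
rewrite E, (ed_form_res _ _ _ _ _ H), (lin_0 S HS) in E2. rewrite E2. vec.
Qed.

Lemma eigen_data_SIE L lam u phi S :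
  eigen_data L lam u phi S -> simple_isolated_eigenvalue L lam.
Proof.
intros [[HL _] Hf [C HC] [HS [D HD]] Hu Lu fL fS SL LS].
exists u, (fun x => phi x = k0), S.
split; [|split; [|split; [|split; [|split; [|split; [|split; [|split]]]]]]]; trivial.
- intros E. apply (k1_neq0 HK). rewrite <- Hu, E. now apply form_0.
- split; [|split; [|split]].
  + now apply form_0.
  + intros x y Hx Hy. rewrite form_add, Hx, Hy by assumption. ring.
  + intros a x Hx. rewrite form_scal, Hx by assumption. ring.
  + intros s l Hs Hl. apply (kabs_eq0 HK).
    destruct (kabs_ge0 HK (phi l)) as [Hp|]; [exfalso | congruence].
    destruct (Hl (kabs (phi l) / (Rabs C + 1))) as [N HN].
    { apply Rdiv_lt_0_compat; [assumption | pose proof (Rabs_pos C); lra]. }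
    specialize (HN N (Nat.le_refl N)).
    pose proof (HC (vsub (s N) l)) as H.
    rewrite form_sub, (Hs N) in H by assumption.
    replace (ksub k0 (phi l)) with (kopp (phi l)) in H by (unfold ksub; ring).
    rewrite (kabs_opp HK) in H.
    pose proof (Rabs_pos C). pose proof (Rle_abs C). pose proof (vnorm_ge0 (vsub (s N) l)).
    apply (Rmult_lt_compat_r (Rabs C + 1)) in HN; [|lra].
    unfold Rdiv in HN. rewrite Rmult_assoc, Rinv_l, Rmult_1_r in HN by lra. nra.
- split.
  + intros x. exists (phi x), (vsub x (vscal (phi x) u)). split; [|vec].
    rewrite form_sub, form_scal, Hu by assumption. unfold ksub. ring.
  + intros a Ha. rewrite form_scal, Hu in Ha by assumption.
    replace a with (@k0 K); [apply vscal_k0|]. rewrite <- Ha. ring.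
- intros g Hg. rewrite fL, Hg. ring.
- intros g Hg. rewrite SL, Hg. vec.
- intros g Hg. rewrite LS, Hg. vec.
- exists D. auto.
Qed.

Lemma SIE_eigen_data L lam u G Rinv phi :
  BL L -> SIE_data L lam u G Rinv -> is_linear_form phi -> is_bounded_form phi ->
  (forall x, phi (L x) = kmul lam (phi x)) -> (forall x, phi x = k0 <-> G x) -> phi u = k1 ->
  eigen_data L lam u phi (Sop phi u Rinv).
Proof.
intros HL [Hu [Lu [[G0 [Gadd [Gscal _]]] [_ [GL [GR [RL [LR [C HC]]]]]]]]] Hf Bf fL fG fu.
pose proof (shift_linear L lam (proj1 HL)) as Hsh.
assert (Gpi : forall x, G (vsub x (vscal (phi x) u))).
{ intros x. apply fG. rewrite form_sub, form_scal, fu by assumption. unfold ksub; ring. }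
assert (Radd : forall x y, G x -> G y -> Rinv (vadd x y) = vadd (Rinv x) (Rinv y)).
{ intros x y Gx Gy. rewrite <- (RL (vadd (Rinv x) (Rinv y))) by auto.
  now rewrite (lin_add (shift L lam)), !LR. }
assert (Rscal : forall a x, G x -> Rinv (vscal a x) = vscal a (Rinv x)).
{ intros a x Gx. rewrite <- (RL (vscal a (Rinv x))) by auto.
  now rewrite (lin_scal (shift L lam)), !LR. }
split; trivial.
- split; [split|].
  + intros x y. unfold Sop. rewrite <- Radd by auto. f_equal.
    rewrite form_add by assumption. vec.
  + intros a x. unfold Sop. rewrite <- Rscal by auto. f_equal.
    rewrite form_scal by assumption. vec.
  + destruct (bounded_form_pos phi Bf) as [D [HD HD']].
    exists (Rabs C * (1 + D * vnorm u)). intros x. unfold Sop.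
    pose proof (HC _ (Gpi x)) as H1.
    pose proof (vnorm_sub x (vscal (phi x) u)) as H2. rewrite ax_norm_scal in H2.
    pose proof (HD' x). pose proof (vnorm_ge0 u). pose proof (vnorm_ge0 x).
    pose proof (Rabs_pos C). pose proof (Rle_abs C).
    pose proof (vnorm_ge0 (vsub x (vscal (phi x) u))).
    apply Rle_trans with (Rabs C * vnorm (vsub x (vscal (phi x) u))); [nra|].
    rewrite Rmult_assoc. apply Rmult_le_compat_l; nra.
- intros x. apply fG. unfold Sop. auto.
- intros x. unfold Sop.
  replace (vsub (shift L lam x) (vscal (phi (shift L lam x)) u))
    with (shift L lam (vsub x (vscal (phi x) u))); [apply RL, Gpi|].
  unfold shift. rewrite (lin_sub L), (lin_scal L), Lu, form_sub, form_scal, fL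
    by (assumption || apply HL). vec.
- intros x. unfold Sop. now rewrite LR.
Qed.

Lemma eigen_perturb L0 lam0 u phi S (p g e : R) L :
  eigen_data L0 lam0 u phi S -> BL L -> 0 <= g -> 0 <= e ->
  (forall x, kabs (phi x) <= p * vnorm x) ->
  (forall x, vnorm (S x) <= g * vnorm x) ->
  (forall x, vnorm (opsub L L0 x) <= e * vnorm x) ->
  6 * (p * vnorm u) * g * e < 1 ->
  exists v phiL SL,
    p * vnorm v <= / 2 /\
    (let w := vadd u v in let mu := phi (opsub L L0 w) in
     v = S (vsub (vscal mu v) (opsub L L0 w)) /\
     eigen_data L (kadd lam0 mu) w phiL SL /\
     forall d, p * vnorm d <= 5 / 4 -> kabs (phi d) <= / 4 -> phiL (vadd w d) <> k0).
Proof.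
intros HD HL Hg He Hp HS HE Hsmall.
pose proof (ed_res_eigenvector HD) as Su.
destruct HD as [BL0 Hf [Cf HCf] BS fu L0u fL0 fS SL LS].
set (E := opsub L L0) in *.
assert (BE : BL E) by now apply BL_sub.
assert (linS := proj1 BS). assert (linE := proj1 BE).
assert (linL := proj1 HL). assert (linL0 := proj1 BL0).
set (t := p * vnorm u) in *.
assert (Ht : 1 <= t).
{ pose proof (Hp u). rewrite fu, (kabs_1 HK) in H. exact H. }
assert (Hu : 0 < vnorm u).
{ apply vnorm_pos. intros E0. unfold t in Ht. rewrite E0, vnorm_0 in Ht. lra. }
assert (Hp0 : 0 < p) by (unfold t in Ht; nra).
assert (Hge : 0 <= g * e) by nra.
set (q := g * e) in *.
assert (Hq : 6 * t * q < 1) by (unfold q; lra).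
assert (HpE : forall x, kabs (phi (E x)) <= p * (e * vnorm x)).
{ intros x. eapply Rle_trans; [apply Hp|]. apply Rmult_le_compat_l; [lra | apply HE]. }
set (F := fun v => S (vsub (vscal (phi (E (vadd u v))) v) (E (vadd u v)))).
destruct (half_contraction_fixpoint (fun v => p * vnorm v <= / 2) F vzero) as [v [Hv Fv]].
- rewrite vnorm_0. lra.
- intros v Hv. unfold F.
  eapply Rle_trans; [apply Rmult_le_compat_l; [lra | apply HS]|].
  pose proof (vnorm_sub (vscal (phi (E (vadd u v))) v) (E (vadd u v))) as H1.
  rewrite ax_norm_scal in H1.
  pose proof (HpE (vadd u v)) as H2. pose proof (HE (vadd u v)) as H3.
  pose proof (ax_norm_triangle _ u v) as H4. pose proof (vnorm_ge0 v) as H5.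
  apply Rle_trans with (p * (g * (e * (vnorm u + vnorm v) * (p * vnorm v + 1)))).
  { apply Rmult_le_compat_l; [lra|]. apply Rmult_le_compat_l; [lra|].
    assert (H6 : e * vnorm (vadd u v) <= e * (vnorm u + vnorm v)) by nra.
    assert (H7 : kabs (phi (E (vadd u v))) <= p * (e * (vnorm u + vnorm v))) by nra.
    nra. }
  replace (p * (g * (e * (vnorm u + vnorm v) * (p * vnorm v + 1))))
    with (q * ((t + p * vnorm v) * (p * vnorm v + 1))) by (unfold q, t; ring).
  apply Rle_trans with (q * (t * (9/4))); [|nra].
  apply Rmult_le_compat_l; [lra|]. assert (0 <= p * vnorm v) by nra. nra.
- intros s l Hs Hl.
  apply Rnot_lt_le. intros H.
  destruct (Hl ((p * vnorm l - / 2) / p)) as [N HN].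
  { apply Rdiv_lt_0_compat; lra. }
  specialize (HN N (Nat.le_refl N)). specialize (Hs N).
  apply (Rmult_lt_compat_l p) in HN; [|lra].
  replace (p * ((p * vnorm l - / 2) / p)) with (p * vnorm l - / 2) in HN by (field; lra).
  pose proof (vnorm_sub (s N) (vsub (s N) l)) as H1.
  replace (vsub (s N) (vsub (s N) l)) with l in H1 by vec. nra.
- intros x y Hx Hy. unfold F. rewrite <- (lin_sub S) by assumption.
  eapply Rle_trans; [apply HS|].
  replace (vsub (vsub (vscal (phi (E (vadd u x))) x) (E (vadd u x)))
                (vsub (vscal (phi (E (vadd u y))) y) (E (vadd u y))))
    with (vsub (vadd (vscal (phi (E (vadd u x))) (vsub x y)) (vscal (phi (E (vsub x y))) y))
               (E (vsub x y))).
  2: { rewrite !(lin_sub E), !(lin_add E), !(form_sub phi), !(form_add phi) by assumption. vec. }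
  set (d := vsub x y).
  pose proof (vnorm_ge0 d) as Hd.
  apply Rle_trans with (g * (e * (t + 2) * vnorm d)).
  { apply Rmult_le_compat_l; [lra|].
    eapply Rle_trans; [apply vnorm_sub|].
    pose proof (ax_norm_triangle _ (vscal (phi (E (vadd u x))) d) (vscal (phi (E d)) y)) as H1.
    rewrite !ax_norm_scal in H1.
    pose proof (HpE (vadd u x)) as H2. pose proof (HpE d) as H3. pose proof (HE d) as H4.
    pose proof (ax_norm_triangle _ u x) as H5. pose proof (vnorm_ge0 y) as H6.
    assert (H7 : kabs (phi (E (vadd u x))) <= e * (t + / 2)).
    { apply Rle_trans with (e * (p * vnorm (vadd u x))); [lra|].
      apply Rmult_le_compat_l; [lra|]. unfold t. nra. }
    assert (H8 : kabs (phi (E d)) * vnorm y <= e * vnorm d * / 2).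
    { apply Rle_trans with (e * vnorm d * (p * vnorm y)); [nra|].
      apply Rmult_le_compat_l; [nra | lra]. }
    assert (H9 : kabs (phi (E (vadd u x))) * vnorm d <= e * (t + / 2) * vnorm d)
      by (apply Rmult_le_compat_r; lra).
    lra. }
  replace (g * (e * (t + 2) * vnorm d)) with (q * (t + 2) * vnorm d) by (unfold q; ring).
  apply Rmult_le_compat_r; [lra | nra].
- set (w := vadd u v). set (mu := phi (E w)).
  assert (fv : phi v = k0) by (rewrite <- Fv; apply fS).
  assert (fw : phi w = k1).
  { unfold w. rewrite form_add, fu, fv by assumption. ring. }
  assert (Hpw : p * vnorm w <= t + / 2).
  { unfold w. pose proof (ax_norm_triangle _ u v). unfold t. nra. }
  assert (Hmu : kabs mu <= e * (t + / 2)).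
  { unfold mu. eapply Rle_trans; [apply HpE|].
    replace (p * (e * vnorm w)) with (e * (p * vnorm w)) by ring.
    apply Rmult_le_compat_l; lra. }
  assert (eqLw : forall x, L x = vadd (L0 x) (E x)) by (intros x; unfold E, opsub; vec).
  assert (Lw : L w = vscal (kadd lam0 mu) w).
  { assert (H : shift L0 lam0 v = vadd (vsub (vscal mu v) (E w)) (vscal mu u)).
    { rewrite <- Fv at 1. unfold F. rewrite LS, form_sub, form_scal, fv by assumption.
      fold w mu. vec. }
    unfold shift in H. rewrite eqLw. unfold w at 1. rewrite (lin_add L0), L0u by assumption.
    replace (L0 v) with (vadd (vsub (L0 v) (vscal lam0 v)) (vscal lam0 v)) by vec.
    rewrite H. fold w.
    change (vscal (kadd lam0 mu) w) with (vscal (kadd lam0 mu) (vadd u v)). vec. }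
  set (T := fun x => S (vsub (vsub (E x) (vscal (phi (E x)) v)) (vscal mu x))).
  assert (linT : is_linear T).
  { split; intros; unfold T.
    - rewrite <- (lin_add S) by assumption. f_equal.
      rewrite (lin_add E), (form_add phi) by assumption. vec.
    - rewrite <- (lin_scal S) by assumption. f_equal.
      rewrite (lin_scal E), (form_scal phi) by assumption. vec. }
  destruct (inverse_id_add T linT) as [N [linN [BN [NT TN]]]].
  { intros x. unfold T. eapply Rle_trans; [apply HS|].
    pose proof (vnorm_sub (vsub (E x) (vscal (phi (E x)) v)) (vscal mu x)) as H1.
    pose proof (vnorm_sub (E x) (vscal (phi (E x)) v)) as H2.
    rewrite ax_norm_scal in H1, H2.
    pose proof (HE x) as H3. pose proof (HpE x) as H4. pose proof (vnorm_ge0 x) as H5.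
    pose proof (vnorm_ge0 v) as H6.
    assert (H7 : kabs (phi (E x)) * vnorm v <= e * vnorm x * / 2).
    { apply Rle_trans with (e * vnorm x * (p * vnorm v)); [nra|].
      apply Rmult_le_compat_l; [nra | lra]. }
    assert (H8 : kabs mu * vnorm x <= e * (t + / 2) * vnorm x)
      by (apply Rmult_le_compat_r; lra).
    apply Rle_trans with (g * (e * (t + 2) * vnorm x)).
    { apply Rmult_le_compat_l; lra. }
    replace (g * (e * (t + 2) * vnorm x)) with (q * (t + 2) * vnorm x) by (unfold q; ring).
    apply Rmult_le_compat_r; [lra | nra]. }
  assert (fNS : forall x, phi (N (S x)) = k0).
  { intros x. replace (N (S x)) with (vsub (S x) (T (N (S x)))).
    - rewrite form_sub by assumption. unfold T at 1. rewrite !fS. unfold ksub; ring.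
    - rewrite <- (NT (S x)) at 1. vec. }
  set (h := fun x => N (S (vsub x (vscal (phi x) w)))).
  assert (linh : is_linear h).
  { split; intros; unfold h.
    - rewrite <- (lin_add N), <- (lin_add S) by assumption. do 2 f_equal.
      rewrite (form_add phi) by assumption. vec.
    - rewrite <- (lin_scal N), <- (lin_scal S) by assumption. do 2 f_equal.
      rewrite (form_scal phi) by assumption. vec. }
  assert (Bh : forall x, vnorm (h x) <= 2 * g * vnorm (vsub x (vscal (phi x) w))).
  { intros x. unfold h. eapply Rle_trans; [apply BN|].
    rewrite Rmult_assoc. apply Rmult_le_compat_l; [lra | apply HS]. }
  assert (fh : forall x, phi (h x) = k0) by (intros x; apply fNS).
  set (phiL := fun x => ksub (phi x) (phi (E (h x)))).
  set (SL' := fun x => vadd (h x) (vscal (phi (E (N (S (h x))))) w)).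
  assert (hker : forall x, phi x = k0 -> h x = N (S x)).
  { intros x Hx. unfold h. rewrite Hx. do 2 f_equal. vec. }
  assert (hw : h w = vzero).
  { unfold h. rewrite fw. replace (vsub w (vscal k1 w)) with (@vzero K X) by vec.
    rewrite (lin_0 S), (lin_0 N); trivial. }
  (* [h] inverts on [ker phi] the compression of [L - lam] along its eigenvector *)
  assert (Lh : forall x, shift L (kadd lam0 mu) (h x) = vsub x (vscal (phiL x) w)).
  { intros x. set (z := vsub x (vscal (phi x) w)).
    assert (fz : phi z = k0).
    { unfold z. rewrite form_sub, form_scal, fw by assumption. unfold ksub; ring. }
    assert (H : h x = vsub (S z) (T (h x))).
    { unfold h. fold z. rewrite <- (NT (S z)) at 2. vec. }
    assert (H1 : shift L0 lam0 (h x) =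
      vsub z (vsub (vsub (vsub (E (h x)) (vscal (phi (E (h x))) v)) (vscal mu (h x)))
                   (vscal (phi (E (h x))) u))).
    { rewrite H at 1. rewrite (lin_sub (shift L0 lam0)) by now apply shift_linear.
      unfold T at 1. rewrite !LS, fz, !form_sub, !form_scal, fh, fv by assumption. vec. }
    unfold shift in *. rewrite eqLw.
    replace (L0 (h x)) with (vadd (vsub (L0 (h x)) (vscal lam0 (h x))) (vscal lam0 (h x))) by vec.
    rewrite H1. unfold phiL, z, w. vec. }
  assert (hL : forall x, h (shift L (kadd lam0 mu) x) = vsub x (vscal (phi x) w) /\
                         phi (shift L (kadd lam0 mu) x) = phi (E (vsub x (vscal (phi x) w)))).
  { intros x. set (z := vsub x (vscal (phi x) w)).
    assert (fz : phi z = k0).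
    { unfold z. rewrite form_sub, form_scal, fw by assumption. unfold ksub; ring. }
    replace (shift L (kadd lam0 mu) x) with (shift L (kadd lam0 mu) z).
    2: { unfold shift, z. rewrite (lin_sub L), (lin_scal L), Lw by assumption. vec. }
    assert (fy : phi (shift L (kadd lam0 mu) z) = phi (E z)).
    { unfold shift. rewrite eqLw, form_sub, form_add, form_scal, fL0, fz by assumption.
      unfold ksub; ring. }
    split; [|assumption].
    unfold h. transitivity (N (vadd z (T z))); [f_equal | apply TN]. rewrite fy.
    replace (vsub (shift L (kadd lam0 mu) z) (vscal (phi (E z)) w)) with
      (vsub (vadd (shift L0 lam0 z)
        (vsub (vsub (E z) (vscal (phi (E z)) v)) (vscal mu z))) (vscal (phi (E z)) u)).
    2: { unfold shift. rewrite eqLw. unfold w. vec. }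
    rewrite (lin_sub S), (lin_add S), (lin_scal S), Su, SL, fz by assumption.
    fold (T z). vec. }
  assert (linphiL : is_linear_form phiL).
  { split; intros; unfold phiL.
    - rewrite (lin_add h), (lin_add E), !(form_add phi) by assumption. unfold ksub; ring.
    - rewrite (lin_scal h), (lin_scal E), !(form_scal phi) by assumption. unfold ksub; ring. }
  assert (phiLw : phiL w = k1).
  { unfold phiL. rewrite hw, (lin_0 E), (form_0 phi), fw by assumption. unfold ksub; ring. }
  assert (Hproj : forall x, vnorm (vsub x (vscal (phi x) w)) <= vnorm x + kabs (phi x) * vnorm w).
  { intros x. rewrite <- ax_norm_scal. apply vnorm_sub. }
  exists v, phiL, SL'. split; [assumption|]. cbv zeta. fold w. fold mu. split; [|split].
  + symmetry. exact Fv.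
  + assert (Bh' : forall x, vnorm (h x) <= 2 * g * (1 + p * vnorm w) * vnorm x).
    { intros x. eapply Rle_trans; [apply Bh|]. rewrite (Rmult_assoc (2 * g)).
      apply Rmult_le_compat_l; [lra|].
      pose proof (Hproj x). pose proof (Hp x). pose proof (vnorm_ge0 w). nra. }
    set (c := 2 * g * (1 + p * vnorm w)) in *.
    assert (Hc : 0 <= c) by (pose proof (vnorm_ge0 w); unfold c; repeat apply Rmult_le_pos; nra).
    split; trivial.
    * exists (p + p * (e * c)). intros x. unfold phiL.
      eapply Rle_trans; [apply (kabs_sub HK)|].
      pose proof (Hp x). pose proof (HpE (h x)). pose proof (Bh' x).
      apply Rle_trans with (p * vnorm x + p * (e * (c * vnorm x))); [|lra].
      apply Rplus_le_compat; [assumption|].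
      eapply Rle_trans; [eassumption|]. apply Rmult_le_compat_l; [lra|].
      apply Rmult_le_compat_l; lra.
    * split; [split|].
      -- intros; unfold SL'. rewrite (lin_add h), (lin_add S), (lin_add N), (lin_add E),
           (form_add phi) by assumption. vec.
      -- intros; unfold SL'. rewrite (lin_scal h), (lin_scal S), (lin_scal N), (lin_scal E),
           (form_scal phi) by assumption. vec.
      -- exists (c + p * (e * (2 * (g * c))) * vnorm w). intros x. unfold SL'.
         assert (B1 : vnorm (N (S (h x))) <= 2 * (g * (c * vnorm x))).
         { eapply Rle_trans; [apply BN|]. apply Rmult_le_compat_l; [lra|].
           eapply Rle_trans; [apply HS|]. apply Rmult_le_compat_l; [lra|]. apply Bh'. }
         assert (B2 : kabs (phi (E (N (S (h x))))) <= p * (e * (2 * (g * (c * vnorm x))))).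
         { eapply Rle_trans; [apply HpE|].
           apply Rmult_le_compat_l; [lra|]. now apply Rmult_le_compat_l. }
         eapply Rle_trans; [apply ax_norm_triangle|]. rewrite ax_norm_scal.
         apply (Rmult_le_compat_r (vnorm w)) in B2; [|apply vnorm_ge0].
         pose proof (Bh' x). lra.
    * intros x.
      assert (H : phiL (shift L (kadd lam0 mu) x) = k0).
      { unfold phiL. destruct (hL x) as [-> ->]. unfold ksub; ring. }
      unfold shift in H. rewrite (form_sub phiL), (form_scal phiL) in H by assumption.
      rewrite <- (Radd_0_l (scalars_ring_theory HK) (kmul _ _)), <- H. unfold ksub; ring.
    * intros x. unfold phiL, SL'.
      rewrite (lin_add h), (lin_scal h), hw, (form_add phi), (form_scal phi), fh, fw by assumption.
      rewrite (hker (h x)) by apply fh. rewrite vscal_vzero, ax_add_0. unfold ksub; ring.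
    * intros x. unfold SL'. destruct (hL x) as [-> _]. unfold phiL. fold (h x). vec.
    * intros x. unfold SL'. rewrite (lin_add (shift L (kadd lam0 mu))) by now apply shift_linear.
      rewrite Lh. unfold shift. rewrite (lin_scal L), Lw by assumption. vec.
  + intros d Hd1 Hd2 H0.
    rewrite (form_add phiL), phiLw in H0 by assumption.
    assert (H1 : kabs (phiL d) = 1).
    { replace (phiL d) with (kopp (@k1 K)); [rewrite (kabs_opp HK); apply (kabs_1 HK)|].
      rewrite <- (Radd_0_l (scalars_ring_theory HK) (kopp k1)), <- H0. ring. }
    pose proof (kabs_sub HK (phi d) (phi (E (h d)))) as H2.
    change (ksub (phi d) (phi (E (h d)))) with (phiL d) in H2. rewrite H1 in H2.
    pose proof (HpE (h d)) as H3.
    assert (H4 : p * vnorm (vsub d (vscal (phi d) w)) <= 5 / 4 + / 4 * (t + / 2)).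
    { pose proof (Hproj d). pose proof (vnorm_ge0 w). pose proof (kabs_ge0 HK (phi d)).
      apply Rle_trans with (p * vnorm d + kabs (phi d) * (p * vnorm w)); [nra|].
      apply Rplus_le_compat; [assumption|]. apply Rmult_le_compat; nra. }
    assert (H5 : p * (e * vnorm (h d)) <= 2 * q * (5 / 4 + / 4 * (t + / 2))).
    { apply Rle_trans with (2 * q * (p * vnorm (vsub d (vscal (phi d) w)))).
      - pose proof (Bh d).
        apply Rle_trans with (p * (e * (2 * g * vnorm (vsub d (vscal (phi d) w)))));
          [|unfold q; lra].
        apply Rmult_le_compat_l; [lra|]. apply Rmult_le_compat_l; lra.
      - apply Rmult_le_compat_l; lra. }
    nra.
Qed.

(** * Symmetrization of multilinear forms *)

Fixpoint lsum {A : Type} (f : A -> K) (l : list A) : K :=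
  match l with nil => k0 | cons x l => kadd (f x) (lsum f l) end.

Lemma lsum_ext {A} (f g : A -> K) l : (forall x, In x l -> f x = g x) -> lsum f l = lsum g l.
Proof. induction l as [|x l IH]; simpl; intros H; [reflexivity | rewrite H, IH; auto]. Qed.

Lemma lsum_map {A B} (f : B -> K) (s : A -> B) l : lsum f (map s l) = lsum (fun x => f (s x)) l.
Proof. induction l; simpl; congruence. Qed.

Lemma lsum_Permutation {A} (f : A -> K) l l' : Permutation l l' -> lsum f l = lsum f l'.
Proof. induction 1; simpl; try congruence. ring. Qed.

Lemma lsum_linear {A} (f g : A -> K) c l :
  lsum (fun x => kadd (kmul c (f x)) (g x)) l = kadd (kmul c (lsum f l)) (lsum g l).
Proof. induction l as [|x l IH]; simpl; [|rewrite IH]; ring. Qed.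

Lemma lsum_bound {A} (f : A -> K) M l : (forall x, In x l -> kabs (f x) <= M) ->
  kabs (lsum f l) <= INR (length l) * M.
Proof.
induction l as [|x l IH]; intros H.
- simpl. rewrite (kabs_0 HK). lra.
- change (length (x :: l)) with (S (length l)). rewrite S_INR. simpl lsum.
  eapply Rle_trans; [apply (kabs_triangle HK)|].
  pose proof (H x (or_introl eq_refl)). pose proof (IH (fun y Hy => H y (or_intror Hy))). lra.
Qed.

Lemma lsum_const {A} (c : K) (l : list A) :
  lsum (fun _ => c) l = kmul (proj1_sig (kofR HK) (INR (length l))) c.
Proof.
destruct (kofR HK) as [f [fD [fM [f1 fabs]]]]; simpl.
induction l as [|x l IH].
- simpl. replace (f 0) with (@k0 K); [ring|]. symmetry. apply (kabs_eq0 HK).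
  rewrite fabs. apply Rabs_R0.
- change (length (x :: l)) with (S (length l)). rewrite S_INR, fD, f1. simpl. rewrite IH. ring.
Qed.

Definition symmetrized (n : nat) (a : (nat -> X -> X) -> K) (h : nat -> X -> X) : K :=
  kmul (proj1_sig (kofR HK) (/ INR (length (index_perms n))))
    (lsum (fun t => a (fun j => h (nth j t O))) (index_perms n)).

Definition multilinear_form (n : nat) (a : (nat -> X -> X) -> K) : Prop :=
  (forall h h', (forall i, (i < n)%nat -> h i = h' i) -> a h = a h') /\
  (forall h i c S T, (forall j, BL (h j)) -> BL S -> BL T -> (i < n)%nat ->
     a (update h i (opadd (opscal c S) T)) =
     kadd (kmul c (a (update h i S))) (a (update h i T))).

Lemma symmetrized_spec (n : nat) (a : (nat -> X -> X) -> K) (M : R) :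
  multilinear_form n a ->
  (forall h, (forall j, BL (h j)) -> kabs (a h) <= M * rprod (fun i => opnorm (h i)) n) ->
  bdd_sym_multilinear n (symmetrized n a) /\
  (forall h, (forall j, BL (h j)) ->
     kabs (symmetrized n a h) <= M * rprod (fun i => opnorm (h i)) n) /\
  (forall T, symmetrized n a (fun _ => T) = a (fun _ => T)).
Proof.
intros [Hext Hlin] Hb.
assert (Hbd : forall h, (forall j, BL (h j)) ->
     kabs (symmetrized n a h) <= M * rprod (fun i => opnorm (h i)) n).
{ intros h Hh. unfold symmetrized. rewrite (kabs_mul HK).
  assert (H := lsum_bound (fun t => a (fun j => h (nth j t O)))
    (M * rprod (fun i => opnorm (h i)) n) (index_perms n)).
  pose proof (index_perms_pos n) as Hl.
  destruct (kofR HK) as [f [fD [fM [f1 fabs]]]]; simpl. rewrite fabs, Rabs_right.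
  2: { apply Rle_ge, Rlt_le, Rinv_0_lt_compat, Hl. }
  apply Rmult_le_reg_l with (INR (length (index_perms n))); [assumption|].
  rewrite <- Rmult_assoc, Rinv_r, Rmult_1_l by lra. apply H.
  intros t Ht. rewrite <- (rprod_index_perm n t (fun i => opnorm (h i)) Ht). now apply Hb. }
split; [split; [|split; [|split]]|split].
- intros h h' H. unfold symmetrized. f_equal. apply lsum_ext. intros t Ht.
  apply Hext. intros i Hi. apply H. now apply (index_perm_nth_lt n).
- intros h i c S T Hh HS HT Hi. unfold symmetrized.
  replace (lsum (fun t => a (fun j => update h i (opadd (opscal c S) T) (nth j t O))) (index_perms n))
    with (lsum (fun t => kadd (kmul c (a (fun j => update h i S (nth j t O))))
                              (a (fun j => update h i T (nth j t O)))) (index_perms n)).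
  { rewrite lsum_linear. ring. }
  apply lsum_ext. intros t Ht.
  destruct (index_perm_surj n t i Ht Hi) as [k [Hk Hki]].
  assert (E : forall R, a (fun j => update h i R (nth j t O)) =
                        a (update (fun j => h (nth j t O)) k R)).
  { intros R. apply Hext. intros j Hj. unfold update.
    destruct (Nat.eqb_spec j k) as [->|Hjk].
    - now rewrite Hki, Nat.eqb_refl.
    - destruct (Nat.eqb_spec (nth j t O) i) as [Hji|]; [exfalso|reflexivity].
      apply Hjk, (index_perm_inj n t); trivial. congruence. }
  rewrite !E, Hlin; auto.
- intros h sigma Hh Hs Hi. unfold symmetrized. f_equal.
  rewrite <- (lsum_Permutation (fun t => a (fun j => h (nth j t O))) _ _
    (index_perms_compose n sigma Hs Hi)), lsum_map.
  apply lsum_ext. intros t Ht. apply Hext. intros i Hlt.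
  rewrite (nth_indep (map sigma t) O (sigma O)), map_nth; [reflexivity|].
  rewrite length_map. apply in_index_perms in Ht. lia.
- exists M. apply Hbd.
- exact Hbd.
- intros T. unfold symmetrized. rewrite lsum_const.
  pose proof (index_perms_pos n) as Hl.
  destruct (kofR HK) as [f [fD [fM [f1 fabs]]]]; simpl.
  transitivity (kmul (f (/ INR (length (index_perms n)) * INR (length (index_perms n))))
                     (a (fun _ => T))).
  + rewrite fM. ring.
  + rewrite Rinv_l, f1 by lra. ring.
Qed.

(** * Power series solution of the fixed point equation *)

Fixpoint vsum (f : nat -> X) (n : nat) : X :=
  match n with O => f O | S m => vadd (vsum f m) (f (S m)) end.

Lemma vsum_ext f g n : (forall i, (i <= n)%nat -> f i = g i) -> vsum f n = vsum g n.
Proof. induction n as [|n IH]; simpl; intros H; [apply H; lia | rewrite H, IH; auto]. Qed.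

Lemma vsum_linear f g c n :
  vsum (fun i => vadd (vscal c (f i)) (g i)) n = vadd (vscal c (vsum f n)) (vsum g n).
Proof. induction n as [|n IH]; simpl; [|rewrite IH]; vec. Qed.

Lemma vsum_add f g n : vsum (fun i => vadd (f i) (g i)) n = vadd (vsum f n) (vsum g n).
Proof. induction n as [|n IH]; simpl; [|rewrite IH]; vec. Qed.

Lemma vsum_sub f g n : vsum (fun i => vsub (f i) (g i)) n = vsub (vsum f n) (vsum g n).
Proof. induction n as [|n IH]; simpl; [|rewrite IH]; vec. Qed.

Lemma vsum_lin (T : X -> X) f n : is_linear T -> vsum (fun i => T (f i)) n = T (vsum f n).
Proof.
intros H. induction n as [|n IH]; simpl; [reflexivity|].
now rewrite IH, (lin_add T) by assumption.
Qed.

Lemma vsum_form (phi : X -> K) f n x : is_linear_form phi ->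
  vsum (fun i => vscal (phi (f i)) x) n = vscal (phi (vsum f n)) x.
Proof.
intros H. induction n as [|n IH]; simpl; [reflexivity|].
rewrite IH, (form_add phi) by assumption. vec.
Qed.

Lemma vsum_shift f n : vsum f (S n) = vadd (f O) (vsum (fun i => f (S i)) n).
Proof.
induction n as [|n IH]; [reflexivity|].
change (vsum f (S (S n))) with (vadd (vsum f (S n)) (f (S (S n)))). rewrite IH. simpl. vec.
Qed.

Lemma vsum_norm f n : vnorm (vsum f n) <= sum_f_R0 (fun i => vnorm (f i)) n.
Proof.
induction n as [|n IH]; simpl; [lra|].
pose proof (ax_norm_triangle _ (vsum f n) (f (S n))). lra.
Qed.

Lemma vsum_cauchy (c : nat -> K) (x : nat -> X) n :
  vsum (fun m => vsum (fun i => vscal (c i) (x (m - i)%nat)) m) n =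
  vsum (fun i => vscal (c i) (vsum x (n - i))) n.
Proof.
induction n as [|n IH]; [reflexivity|].
change (vadd (vsum (fun m => vsum (fun i => vscal (c i) (x (m - i)%nat)) m) n)
             (vsum (fun i => vscal (c i) (x (S n - i)%nat)) (S n)) =
        vsum (fun i => vscal (c i) (vsum x (S n - i))) (S n)).
rewrite IH. cbn [vsum]. rewrite Nat.sub_diag, ax_add_assoc. f_equal.
rewrite <- vsum_add. apply vsum_ext. intros i Hi.
rewrite Nat.sub_succ_l by assumption. cbn [vsum]. now rewrite ax_scal_distr_v.
Qed.

Lemma update_shift_lt (h : nat -> X -> X) a i T : (i < a)%nat ->
  (fun j => update h i T (a + j)%nat) = (fun j => h (a + j)%nat).
Proof.
intros H. apply functional_extensionality; intros j. unfold update.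
destruct (Nat.eqb_spec (a + j) i); [lia | reflexivity].
Qed.

Lemma update_shift_ge (h : nat -> X -> X) a i T :
  (fun j => update h (a + i) T (a + j)%nat) = update (fun j => h (a + j)%nat) i T.
Proof.
apply functional_extensionality; intros j. unfold update.
destruct (Nat.eqb_spec (a + j) (a + i)), (Nat.eqb_spec j i); trivial; lia.
Qed.

(* Degree [n] part of the solution of [w = u + S (phi (E w) w - E w)], polarized without
   symmetrization; the fuel [k] only has to be at least [n]. *)
Fixpoint wcoef (u : X) (phi : X -> K) (Sr : X -> X) (k n : nat) (h : nat -> X -> X) : X :=
  match k, n with
  | _, O => u
  | O, S _ => vzero
  | S k, S m =>
    let w i := wcoef u phi Sr k i (fun j => h (1 + j)%nat) in
    Sr (vsub (vsum (fun i => vscal (phi (h O (w i)))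
                               (wcoef u phi Sr k (m - i) (fun j => h (S i + j)%nat))) m)
             (h O (w m)))
  end.

Fixpoint wmajor (U p g : R) (k n : nat) : R :=
  match k, n with
  | _, O => U
  | O, S _ => 0
  | S k, S m =>
    g * (p * sum_f_R0 (fun i => wmajor U p g k i * wmajor U p g k (m - i)) m + wmajor U p g k m)
  end.

Section Coefficients.
Variables (u : X) (phi : X -> K) (Sr : X -> X).
Hypotheses (Hphi : is_linear_form phi) (HSr : is_linear Sr).

Lemma wcoef_ext k n h h' : (forall i, (i < n)%nat -> h i = h' i) ->
  wcoef u phi Sr k n h = wcoef u phi Sr k n h'.
Proof.
revert n h h'; induction k as [|k IH]; intros [|m] h h' H; try reflexivity.
cbn [wcoef].
assert (E : forall i, (i <= m)%nat -> wcoef u phi Sr k i (fun j => h (1 + j)%nat) =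
                                      wcoef u phi Sr k i (fun j => h' (1 + j)%nat)).
{ intros i Hi. apply IH. intros j Hj. apply H. lia. }
f_equal. rewrite (H O), E by lia. f_equal. apply vsum_ext. intros i Hi.
rewrite E by assumption. f_equal. apply IH. intros j Hj. apply H. lia.
Qed.

Lemma wcoef_linear k n h i c P Q : (forall j, BL (h j)) -> BL P -> BL Q -> (i < n)%nat ->
  wcoef u phi Sr k n (update h i (opadd (opscal c P) Q)) =
  vadd (vscal c (wcoef u phi Sr k n (update h i P))) (wcoef u phi Sr k n (update h i Q)).
Proof.
revert n h i; induction k as [|k IH]; intros [|m] h i Hh HP HQ Hi; try lia.
{ cbn [wcoef]. vec. }
cbn [wcoef]. rewrite <- (lin_scal Sr), <- (lin_add Sr) by assumption. f_equal.
destruct i as [|i].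
- assert (E0 : forall R, update h 0 R O = R) by reflexivity.
  rewrite !E0, !(update_shift_lt h 1 0) by lia.
  assert (E1 : forall R, vsum (fun i => vscal (phi (R (wcoef u phi Sr k i (fun j => h (1 + j)%nat))))
      (wcoef u phi Sr k (m - i) (fun j => update h 0 R (S i + j)%nat))) m =
    vsum (fun i => vscal (phi (R (wcoef u phi Sr k i (fun j => h (1 + j)%nat))))
      (wcoef u phi Sr k (m - i) (fun j => h (S i + j)%nat))) m).
  { intros R. apply vsum_ext; intros i _. now rewrite update_shift_lt by lia. }
  rewrite (E1 P), (E1 Q), (E1 (opadd (opscal c P) Q)). unfold opadd, opscal.
  rewrite (vsum_ext _ (fun i =>
    vadd (vscal c (vscal (phi (P (wcoef u phi Sr k i (fun j => h (1 + j)%nat))))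
                           (wcoef u phi Sr k (m - i) (fun j => h (S i + j)%nat))))
         (vscal (phi (Q (wcoef u phi Sr k i (fun j => h (1 + j)%nat))))
                           (wcoef u phi Sr k (m - i) (fun j => h (S i + j)%nat))))).
  2: { intros i _.
       rewrite (form_add phi), (form_scal phi) by assumption. vec. }
  rewrite vsum_linear. vec.
- change (S i) with (1 + i)%nat.
  assert (E0 : forall R, update h (1 + i) R O = h O) by reflexivity.
  rewrite !E0, !(update_shift_ge h 1 i).
  set (h1 := fun j => h (1 + j)%nat).
  assert (Hh1 : forall j, BL (h1 j)) by (intros; apply Hh).
  assert (linh : is_linear (h O)) by apply Hh.
  rewrite (IH m h1 i), (lin_add (h O)), (lin_scal (h O)) by (assumption || lia).
  rewrite (vsum_ext _ (fun a =>
    vadd (vscal c (vscal (phi (h O (wcoef u phi Sr k a (update h1 i P))))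
           (wcoef u phi Sr k (m - a) (fun j => update h (1 + i) P (S a + j)%nat))))
         (vscal (phi (h O (wcoef u phi Sr k a (update h1 i Q))))
           (wcoef u phi Sr k (m - a) (fun j => update h (1 + i) Q (S a + j)%nat))))).
  { rewrite vsum_linear. vec. }
  intros a Ha. destruct (le_lt_dec a i) as [Hai | Hai].
  + assert (E1 : forall R, wcoef u phi Sr k a (update h1 i R) = wcoef u phi Sr k a h1).
    { intros R. apply wcoef_ext. intros j Hj. unfold update.
      destruct (Nat.eqb_spec j i); [lia | reflexivity]. }
    assert (E2 : forall R, (fun j => update h (1 + i) R (S a + j)%nat) =
                           update (fun j => h (S a + j)%nat) (i - a) R).
    { intros R. replace (1 + i)%nat with (S a + (i - a))%nat by lia. apply update_shift_ge. }
    rewrite !E1, !E2, IH by (trivial; lia). vec.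
  + rewrite (IH a h1 i) by (trivial; lia).
    rewrite (lin_add (h O)), (lin_scal (h O)), (form_add phi), (form_scal phi) by assumption.
    rewrite !update_shift_lt by lia. vec.
Qed.

Lemma wcoef_fuel k n h : (n <= k)%nat -> wcoef u phi Sr k n h = wcoef u phi Sr n n h.
Proof.
assert (H : forall k n h, (n <= k)%nat -> wcoef u phi Sr (S k) n h = wcoef u phi Sr k n h).
{ clear k n h. induction k as [|k IH]; intros [|m] h Hm; try lia; try reflexivity.
  change (wcoef u phi Sr (S (S k)) (S m) h) with
    (Sr (vsub (vsum (fun i => vscal (phi (h O (wcoef u phi Sr (S k) i (fun j => h (1 + j)%nat))))
       (wcoef u phi Sr (S k) (m - i) (fun j => h (S i + j)%nat))) m)
             (h O (wcoef u phi Sr (S k) m (fun j => h (1 + j)%nat))))).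
  change (wcoef u phi Sr (S k) (S m) h) with
    (Sr (vsub (vsum (fun i => vscal (phi (h O (wcoef u phi Sr k i (fun j => h (1 + j)%nat))))
       (wcoef u phi Sr k (m - i) (fun j => h (S i + j)%nat))) m)
             (h O (wcoef u phi Sr k m (fun j => h (1 + j)%nat))))).
  rewrite (IH m) by lia. do 2 f_equal. apply vsum_ext. intros i Hi. now rewrite !IH by lia. }
intros Hn. induction Hn as [|k Hn IH]; [reflexivity|]. now rewrite H.
Qed.

Lemma wcoef_step n (E : X -> X) : let x i := wcoef u phi Sr i i (fun _ => E) in
  x (S n) = Sr (vsub (vsum (fun i => vscal (phi (E (x i))) (x (n - i)%nat)) n) (E (x n))).
Proof.
cbv zeta. cbn [wcoef]. do 2 f_equal. apply vsum_ext. intros i Hi.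
now rewrite !(wcoef_fuel n) by lia.
Qed.

Variables (p g : R).
Hypotheses (Hp : forall x, kabs (phi x) <= p * vnorm x)
           (Hg : forall x, vnorm (Sr x) <= g * vnorm x) (Hp0 : 0 <= p) (Hg0 : 0 <= g).

Lemma wmajor_ge0 k n : 0 <= wmajor (vnorm u) p g k n.
Proof.
revert n; induction k as [|k IH]; intros [|m]; simpl; try apply vnorm_ge0; [lra|].
apply Rmult_le_pos; [lra|]. apply Rplus_le_le_0_compat; [|apply IH].
apply Rmult_le_pos; [lra|]. apply cond_pos_sum. intros i. now apply Rmult_le_pos.
Qed.

Lemma wcoef_bound k n h : (forall j, BL (h j)) ->
  vnorm (wcoef u phi Sr k n h) <= wmajor (vnorm u) p g k n * rprod (fun i => opnorm (h i)) n.
Proof.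
revert n h; induction k as [|k IH]; intros [|m] h Hh; try (simpl; rewrite ?vnorm_0; lra).
assert (Hpos : forall i, 0 <= opnorm (h i)) by (intros i; apply opnorm_ge0, Hh).
cbn [wcoef wmajor].
set (w := fun i => wcoef u phi Sr k i (fun j => h (1 + j)%nat)).
set (b := fun i => wmajor (vnorm u) p g k i).
set (q := fun a n => rprod (fun i => opnorm (h (a + i)%nat)) n).
assert (Hq : forall a n, 0 <= q a n) by (intros; now apply rprod_ge0).
assert (Hb : forall n, 0 <= b n) by (intros; apply wmajor_ge0).
assert (Hq0 : rprod (fun i => opnorm (h i)) (S m) = opnorm (h O) * q 1%nat m).
{ change (S m) with (1 + m)%nat. rewrite rprod_add. unfold q. cbn [rprod]. ring. }
assert (Hhw : forall i, vnorm (h O (w i)) <= opnorm (h O) * (b i * q 1%nat i)).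
{ intros i. eapply Rle_trans; [now apply opnorm_bound|].
  apply Rmult_le_compat_l; [apply Hpos|]. now apply (IH i (fun j => h (1 + j)%nat)). }
rewrite Hq0.
eapply Rle_trans; [apply Hg|]. rewrite (Rmult_assoc g). apply Rmult_le_compat_l; [lra|].
eapply Rle_trans; [apply vnorm_sub|]. rewrite Rmult_plus_distr_r.
apply Rplus_le_compat.
- eapply Rle_trans; [apply vsum_norm|].
  rewrite Rmult_assoc, (Rmult_comm (sum_f_R0 _ _)), <- Rmult_assoc, scal_sum.
  apply sum_Rle. intros i Hi. rewrite ax_norm_scal.
  assert (Hsplit : q 1%nat m = q 1%nat i * q (S i) (m - i)%nat).
  { unfold q. replace m with (i + (m - i))%nat at 1 by lia. now rewrite rprod_add. }
  pose proof (IH (m - i)%nat (fun j => h (S i + j)%nat) ltac:(intros; apply Hh)) as H1.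
  pose proof (Hp (h O (w i))) as H2. pose proof (Hhw i) as H3.
  fold (b (m - i)%nat) in H1. fold (q (S i) (m - i)%nat) in H1.
  fold (b i) (b (m - i)%nat).
  apply Rle_trans with ((p * (opnorm (h O) * (b i * q 1%nat i))) * (b (m - i)%nat * q (S i) (m - i)%nat)).
  + apply Rmult_le_compat; trivial; [apply (kabs_ge0 HK) | apply vnorm_ge0 |].
    eapply Rle_trans; [apply H2|]. now apply Rmult_le_compat_l.
  + rewrite Hsplit. right. ring.
- eapply Rle_trans; [apply Hhw|]. right. unfold b. ring.
Qed.

Lemma wmajor_bound Rr : 0 < Rr ->
  Rr * g * (p * (2 * vnorm u) + 1) * 2 <= 1 ->
  forall k n, wmajor (vnorm u) p g k n <= 2 * vnorm u / Rr ^ n.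
Proof.
intros HR Hsm. set (U := vnorm u) in *.
assert (HU : 0 <= U) by apply vnorm_ge0.
set (b := wmajor U p g).
assert (Hb : forall k n, 0 <= b k n) by (intros; apply wmajor_ge0).
assert (HRn : forall n, 0 < Rr ^ n) by (intros; now apply pow_lt).
assert (Hpart : forall k N, sum_f_R0 (fun n => b k n * Rr ^ n) N <= 2 * U).
{ assert (H0 : forall k, b k O = U) by now intros [|k].
  induction k as [|k IH]; intros [|N].
  - simpl. rewrite H0. lra.
  - rewrite decomp_sum by lia. rewrite H0. simpl pred.
    rewrite (sum_eq _ (fun _ => 0)).
    + rewrite sum_cte. simpl. lra.
    + intros i _. unfold b. simpl. ring.
  - simpl. rewrite H0. lra.
  - rewrite decomp_sum by lia. rewrite H0. simpl pred.
    set (y := fun n => b k n * Rr ^ n).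
    rewrite (sum_eq _ (fun n => sum_f_R0 (fun i => y i * y (n - i)%nat) n * (Rr * g * p)
                                 + y n * (Rr * g))).
    2: { intros n _. change (b (S k) (S n)) with
           (g * (p * sum_f_R0 (fun i => b k i * b k (n - i)%nat) n + b k n)).
         replace (sum_f_R0 (fun i => y i * y (n - i)%nat) n)
           with (sum_f_R0 (fun i => b k i * b k (n - i)%nat) n * Rr ^ n).
         - unfold y. simpl. ring.
         - rewrite (Rmult_comm _ (Rr ^ n)), scal_sum. apply sum_eq. intros i Hi. unfold y.
           replace (Rr ^ n) with (Rr ^ i * Rr ^ (n - i))
             by (rewrite <- pow_add; f_equal; lia). ring. }
    rewrite sum_plus, <- !scal_sum.
    assert (Hy : forall n, 0 <= y n)
      by (intros; apply Rmult_le_pos; [apply Hb | now apply Rlt_le]).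
    assert (Hs := IH N). fold y in Hs.
    assert (Hs0 : 0 <= sum_f_R0 y N) by now apply cond_pos_sum.
    assert (Hc : sum_f_R0 (fun n => sum_f_R0 (fun i => y i * y (n - i)%nat) n) N
                 <= sum_f_R0 y N * sum_f_R0 y N).
    { destruct (Nat.eq_0_gt_0_cases N) as [-> | HN]; [simpl; lra|].
      rewrite cauchy_finite by assumption.
      rewrite <- Rplus_0_r at 1. apply Rplus_le_compat_l.
      apply cond_pos_sum. intros i. apply cond_pos_sum. intros j. now apply Rmult_le_pos. }
    assert (Hc2 : sum_f_R0 y N * sum_f_R0 y N <= 2 * U * (2 * U)) by nra.
    assert (Hgp : 0 <= Rr * g * p) by (repeat apply Rmult_le_pos; lra).
    assert (Hgr : 0 <= Rr * g) by (apply Rmult_le_pos; lra).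
    apply Rle_trans with (U + (Rr * g * p * (2 * U * (2 * U)) + Rr * g * (2 * U))).
    + apply Rplus_le_compat; [simpl; lra|]. apply Rplus_le_compat; apply Rmult_le_compat_l; lra.
    + nra. }
intros k n. apply Rmult_le_reg_r with (Rr ^ n); [apply HRn|].
unfold Rdiv. rewrite Rmult_assoc, Rinv_l, Rmult_1_r by (apply Rgt_not_eq, HRn).
eapply Rle_trans; [|apply (Hpart k n)]. fold b.
destruct n as [|n]; [simpl; lra|].
change (sum_f_R0 (fun n => b k n * Rr ^ n) (S n))
  with (sum_f_R0 (fun n => b k n * Rr ^ n) n + b k (S n) * Rr ^ S n).
assert (0 <= sum_f_R0 (fun n => b k n * Rr ^ n) n); [|lra].
apply cond_pos_sum. intros i. apply Rmult_le_pos; [apply Hb | now apply Rlt_le].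
Qed.

(* The errors [e_N = w - sum_(i<=N) x_i] satisfy
   [e_(N+1) = Sr (sum_i phi (E x_i) e_(N-i) + phi (E e_N) w - E e_N)]. *)
Lemma wcoef_sum_error (E : X -> X) (eps Rr : R) (w : X) :
  BL E -> (forall x, vnorm (E x) <= eps * vnorm x) -> opnorm E = eps ->
  0 < Rr -> Rr * g * (p * (2 * vnorm u) + 1) * 2 <= 1 -> 4 * eps <= Rr ->
  w = vadd u (Sr (vsub (vscal (phi (E w)) w) (E w))) ->
  g * eps * (4 * (p * vnorm u) + p * vnorm w + 1) <= / 2 ->
  forall N, vnorm (vsub w (vsum (fun i => wcoef u phi Sr i i (fun _ => E)) N)) <=
            vnorm (vsub w u) * (/2) ^ N.
Proof.
intros BE HE Heps HR Hsm H4 Hw Hc.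
assert (linE := proj1 BE).
assert (Heps0 : 0 <= eps) by (rewrite <- Heps; apply opnorm_ge0, BE).
set (U := vnorm u) in *. assert (HU : 0 <= U) by apply vnorm_ge0.
set (x := fun i => wcoef u phi Sr i i (fun _ => E)).
set (C := vnorm (vsub w u)). assert (HC : 0 <= C) by apply vnorm_ge0.
set (V := fun N => vsum x N). set (er := fun N => vsub w (V N)).
assert (Hx : forall i, vnorm (x i) <= 2 * U * (/4) ^ i).
{ intros i. pose proof (wcoef_bound i i (fun _ => E) (fun _ => BE)) as HB. cbv beta in HB.
  rewrite rprod_const, Heps in HB. eapply Rle_trans; [exact HB|].
  apply Rle_trans with (2 * U / Rr ^ i * eps ^ i).
  - apply Rmult_le_compat_r; [now apply pow_le | now apply wmajor_bound].
  - unfold Rdiv. rewrite Rmult_assoc. apply Rmult_le_compat_l; [lra|].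
    rewrite <- pow_inv, <- Rpow_mult_distr. apply pow_incr. split.
    + apply Rmult_le_pos; [apply Rlt_le, Rinv_0_lt_compat|]; lra.
    + apply Rmult_le_reg_l with Rr; [lra|]. rewrite <- Rmult_assoc, Rinv_r by lra. lra. }
assert (Hstep : forall N, er (S N) = Sr (vsub (vadd
    (vsum (fun i => vscal (phi (E (x i))) (er (N - i)%nat)) N)
    (vscal (phi (E (er N))) w)) (E (er N)))).
{ intros N. unfold er at 1, V. rewrite vsum_shift. unfold x at 1. cbn [wcoef].
  rewrite (vsum_ext (fun i => x (S i)) (fun n =>
    Sr (vsub (vsum (fun i => vscal (phi (E (x i))) (x (n - i)%nat)) n) (E (x n)))))
    by (intros; apply wcoef_step).
  rewrite (vsum_lin Sr), vsum_sub, (vsum_lin E) by assumption. fold (V N).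
  rewrite (vsum_cauchy (fun i => phi (E (x i))) x).
  rewrite (vsum_ext (fun i => vscal (phi (E (x i))) (er (N - i)%nat))
    (fun i => vsub (vscal (phi (E (x i))) w) (vscal (phi (E (x i))) (vsum x (N - i)))))
    by (intros; unfold er, V; vec).
  rewrite vsum_sub, (vsum_form phi (fun i => E (x i))), (vsum_lin E) by assumption. fold (V N).
  rewrite Hw at 1.
  set (Y := vsum (fun i => vscal (phi (E (x i))) (vsum x (N - i))) N).
  replace (vsub (vadd u (Sr (vsub (vscal (phi (E w)) w) (E w)))) (vadd u (Sr (vsub Y (E (V N))))))
    with (vsub (Sr (vsub (vscal (phi (E w)) w) (E w))) (Sr (vsub Y (E (V N))))) by vec.
  rewrite <- (lin_sub Sr) by assumption. f_equal. unfold er.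
  rewrite (lin_sub E), (form_sub phi) by assumption. vec. }
assert (Hhalf : forall n, 0 < (/2) ^ n) by (intros; apply pow_lt; lra).
assert (Hgeo : forall n, sum_f_R0 (fun i => (/2) ^ i) n <= 2).
{ intros n. assert (sum_f_R0 (fun i => (/2) ^ i) n = 2 - (/2) ^ n).
  { induction n as [|n IH]; [simpl; lra|]. rewrite tech5, IH. simpl. lra. }
  pose proof (Hhalf n). lra. }
intros N. fold x. fold (V N). fold (er N).
induction N as [N IH] using (well_founded_induction lt_wf).
destruct N as [|N].
{ unfold er, V, x. simpl. fold C. lra. }
rewrite Hstep. eapply Rle_trans; [apply Hg|].
assert (HeN := IH N (Nat.lt_succ_diag_r N)).
assert (HpE : forall y, kabs (phi (E y)) <= p * (eps * vnorm y)).
{ intros y. eapply Rle_trans; [apply Hp|]. now apply Rmult_le_compat_l. }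
assert (H1 : vnorm (vsum (fun i => vscal (phi (E (x i))) (er (N - i)%nat)) N) <=
             eps * (4 * (p * U)) * (C * (/2) ^ N)).
{ eapply Rle_trans; [apply vsum_norm|].
  apply Rle_trans with (p * eps * (2 * U) * (C * (/2) ^ N) * sum_f_R0 (fun i => (/2) ^ i) N).
  - rewrite scal_sum. apply sum_Rle. intros i Hi. rewrite ax_norm_scal.
    assert (Hp2 : (/2) ^ N = (/2) ^ i * (/2) ^ (N - i)) by (rewrite <- pow_add; f_equal; lia).
    assert (Hp4 : (/4) ^ i = (/2) ^ i * (/2) ^ i)
      by (rewrite <- Rpow_mult_distr; f_equal; lra).
    apply Rle_trans with (p * (eps * (2 * U * (/4) ^ i)) * (C * (/2) ^ (N - i))).
    + apply Rmult_le_compat; [apply (kabs_ge0 HK) | apply vnorm_ge0 | |].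
      * eapply Rle_trans; [apply HpE|]. apply Rmult_le_compat_l; [lra|].
        now apply Rmult_le_compat_l.
      * apply IH. lia.
    + rewrite Hp2, Hp4. right. ring.
  - apply Rle_trans with (p * eps * (2 * U) * (C * (/2) ^ N) * 2).
    + apply Rmult_le_compat_l; [|apply Hgeo]. pose proof (Hhalf N).
      repeat apply Rmult_le_pos; lra.
    + right. ring. }
assert (H2 : vnorm (vscal (phi (E (er N))) w) <= eps * (p * vnorm w) * (C * (/2) ^ N)).
{ rewrite ax_norm_scal. apply Rle_trans with (p * (eps * (C * (/2) ^ N)) * vnorm w); [|right; ring].
  apply Rmult_le_compat_r; [apply vnorm_ge0|]. eapply Rle_trans; [apply HpE|].
  apply Rmult_le_compat_l; [lra|]. now apply Rmult_le_compat_l. }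
assert (H3 : vnorm (E (er N)) <= eps * 1 * (C * (/2) ^ N)).
{ eapply Rle_trans; [apply HE|]. rewrite Rmult_1_r. now apply Rmult_le_compat_l. }
apply Rle_trans with (g * eps * (4 * (p * U) + p * vnorm w + 1) * (C * (/2) ^ N)).
- replace (g * eps * (4 * (p * U) + p * vnorm w + 1) * (C * (/2) ^ N)) with
    (g * (eps * (4 * (p * U)) * (C * (/2) ^ N) + eps * (p * vnorm w) * (C * (/2) ^ N)
      + eps * 1 * (C * (/2) ^ N))) by ring.
  apply Rmult_le_compat_l; [lra|].
  eapply Rle_trans; [apply vnorm_sub|]. apply Rplus_le_compat; [|assumption].
  eapply Rle_trans; [apply ax_norm_triangle|]. now apply Rplus_le_compat.
- simpl. apply Rle_trans with (/ 2 * (C * (/2) ^ N)); [|lra].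
  apply Rmult_le_compat_r; [|assumption]. pose proof (Hhalf N). now apply Rmult_le_pos; [|lra].
Qed.

End Coefficients.

(** * Analyticity of the eigenvalue *)

Lemma eigen_local_series L1 lam1 u phi Sr delta :
  eigen_data L1 lam1 u phi Sr -> 0 < delta ->
  exists (A : nat -> (nat -> X -> X) -> K) (M : nat -> R) (r : R),
    0 < r /\
    (forall n, bdd_sym_multilinear n (A n)) /\
    (forall n h, (forall j, BL (h j)) ->
        kabs (A n h) <= M n * rprod (fun i => opnorm (h i)) n) /\
    (exists s, Un_cv (fun N => sum_f_R0 (fun n => M n * r ^ n) N) s) /\
    (forall L, BL L -> opnorm (opsub L L1) < r -> exists x lam,
        vnorm x <= delta /\ L (vadd u x) = vscal lam (vadd u x) /\
        kseries_conv (fun n => A n (fun _ => opsub L L1)) lam).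
Proof.
intros HD Hdelta.
pose proof (ed_res_eigenvector HD) as Su.
assert (HD' := HD). destruct HD' as [BL1 Hf Bf [linS BS] fu L1u fL1 fS SL LS].
destruct (bounded_form_pos phi Bf) as [p [Hp0 Hp]].
destruct (bounded_pos Sr BS) as [g [Hg0 Hg]].
set (U := vnorm u). assert (HU : 0 <= U) by apply vnorm_ge0.
set (t := p * U). assert (Ht : 0 <= t) by (apply Rmult_le_pos; lra).
set (Rr := / (g * (p * (2 * U) + 1) * 2)).
assert (HpU : 0 <= p * (2 * U)) by (apply Rmult_le_pos; lra).
assert (Hden : 0 < g * (p * (2 * U) + 1) * 2).
{ apply Rmult_lt_0_compat; [apply Rmult_lt_0_compat|]; lra. }
assert (HRr : 0 < Rr) by now apply Rinv_0_lt_compat.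
assert (HRr1 : Rr * g * (p * (2 * U) + 1) * 2 <= 1).
{ replace (Rr * g * (p * (2 * U) + 1) * 2) with (Rr * (g * (p * (2 * U) + 1) * 2)) by ring.
  unfold Rr. rewrite Rinv_l; lra. }
set (a := fun n (h : nat -> X -> X) => match n with
  | O => lam1
  | S m => phi (h O (wcoef u phi Sr m m (fun j => h (1 + j)%nat)))
  end).
set (c := kabs lam1 + 2 * p * U * Rr).
set (M := fun n => c / Rr ^ n).
assert (HRn : forall n, 0 < Rr ^ n) by (intros; now apply pow_lt).
assert (Hlin : forall n, multilinear_form n (a n)).
{ intros [|m]; split; simpl; try (intros; lia); trivial.
  - intros h h' H. rewrite (H O) by lia. do 2 f_equal. apply wcoef_ext. intros j Hj. apply H. lia.
  - intros h [|i] b P Q Hh HP HQ Hi.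
    + assert (E : forall R, wcoef u phi Sr m m (fun j => update h 0 R (S j)) =
                            wcoef u phi Sr m m (fun j => h (S j))) by reflexivity.
      rewrite !E. unfold update, opadd, opscal. simpl.
      now rewrite (form_add phi), (form_scal phi) by assumption.
    + assert (E : forall R, (fun j => update h (S i) R (S j)) = update (fun j => h (S j)) i R)
        by (intros R; apply (update_shift_ge h 1 i)).
      rewrite !E, wcoef_linear by (trivial; try lia; intros; apply Hh).
      unfold update. simpl. destruct (Hh O) as [Hh0 _].
      now rewrite (lin_add (h O)), (lin_scal (h O)), (form_add phi), (form_scal phi). }
assert (Hbd : forall n h, (forall j, BL (h j)) ->
  kabs (a n h) <= M n * rprod (fun i => opnorm (h i)) n).
{ assert (Hc : 0 <= 2 * p * U * Rr) by (repeat apply Rmult_le_pos; lra).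
  intros [|m] h Hh; unfold M, a.
  - simpl. unfold c. rewrite Rmult_1_r. unfold Rdiv. rewrite Rinv_1. lra.
  - assert (Hh' : forall j, BL (h (1 + j)%nat)) by (intros; apply Hh).
    pose proof (wcoef_bound u phi Sr p g Hp Hg (Rlt_le _ _ Hp0) (Rlt_le _ _ Hg0) m m _ Hh') as H1.
    pose proof (wmajor_bound u p g (Rlt_le _ _ Hp0) (Rlt_le _ _ Hg0) Rr HRr HRr1 m m) as H2.
    fold U in H1, H2. cbv beta in H1.
    assert (Hr0 : 0 <= rprod (fun i => opnorm (h (1 + i)%nat)) m)
      by (apply rprod_ge0; intros; apply opnorm_ge0, Hh).
    change (rprod (fun i => opnorm (h i)) (S m)) with (rprod (fun i => opnorm (h i)) (1 + m)).
    rewrite rprod_add. cbn [rprod].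
    set (q := rprod (fun i => opnorm (h (1 + i)%nat)) m) in *.
    assert (Ho : 0 <= opnorm (h O)) by apply opnorm_ge0, Hh.
    eapply Rle_trans; [apply Hp|].
    apply Rle_trans with (p * (opnorm (h O) * (2 * U / Rr ^ m * q))).
    + apply Rmult_le_compat_l; [lra|].
      eapply Rle_trans; [now apply opnorm_bound|]. apply Rmult_le_compat_l; [assumption|].
      eapply Rle_trans; [apply H1|]. now apply Rmult_le_compat_r.
    + apply Rle_trans with (2 * p * U * Rr / Rr ^ S m * (opnorm (h O) * q)).
      * right. simpl. field. split; [apply Rgt_not_eq, HRn | lra].
      * rewrite Rmult_1_l. apply Rmult_le_compat_r; [now apply Rmult_le_pos|].
        apply Rmult_le_compat_r; [apply Rlt_le, Rinv_0_lt_compat, HRn|].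
        unfold c. pose proof (kabs_ge0 HK lam1). lra. }
set (y := U + / (2 * p)).
assert (Hy : 0 < y).
{ assert (0 < / (2 * p)) by (apply Rinv_0_lt_compat; lra). unfold y. lra. }
set (r1 := / (g * (10 * t + 3))). set (r2 := delta / (g * (2 * y))).
assert (Hd1 : 0 < g * (10 * t + 3)) by (apply Rmult_lt_0_compat; lra).
assert (Hd2 : 0 < g * (2 * y)) by (apply Rmult_lt_0_compat; lra).
assert (Hr1 : 0 < r1) by now apply Rinv_0_lt_compat.
assert (Hr2 : 0 < r2) by now apply Rdiv_lt_0_compat.
exists (fun n => symmetrized n (a n)), M, (Rmin (Rr / 4) (Rmin r1 r2)).
set (r := Rmin (Rr / 4) (Rmin r1 r2)).
assert (Hr : 0 < r) by (repeat apply Rmin_glb_lt; lra).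
assert (Hr4 : r <= Rr / 4) by apply Rmin_l.
assert (Hrr1 : r <= r1) by (eapply Rle_trans; [apply Rmin_r | apply Rmin_l]).
assert (Hrr2 : r <= r2) by (eapply Rle_trans; [apply Rmin_r | apply Rmin_r]).
split; [assumption|].
split; [|split; [|split]].
- intros n. apply (symmetrized_spec n (a n) (M n) (Hlin n) (Hbd n)).
- intros n. apply (symmetrized_spec n (a n) (M n) (Hlin n) (Hbd n)).
- set (z := r / Rr). assert (Hz : 0 <= z <= / 4).
  { split; [apply Rlt_le; now apply Rdiv_lt_0_compat|].
    apply Rmult_le_reg_r with Rr; [assumption|]. unfold z, Rdiv.
    rewrite Rmult_assoc, Rinv_l by lra. lra. }
  exists (/ (1 - z) * c).
  assert (Hg1 : Un_cv (sum_f_R0 (fun n => 1 * z ^ n)) (/ (1 - z))).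
  { apply (GP_infinite z). rewrite Rabs_right; lra. }
  assert (Hcc : Un_cv (fun _ : nat => c) c).
  { intros eps He. exists O. intros n _. unfold Rdist. rewrite Rminus_diag, Rabs_R0. assumption. }
  eapply Un_cv_ext; [|exact (CV_mult _ _ _ _ Hg1 Hcc)].
  intros n. cbv beta. rewrite Rmult_comm, scal_sum. apply sum_eq. intros i _.
  unfold M, z, Rdiv. rewrite Rpow_mult_distr, pow_inv. ring.
- intros L HL Hlt. set (E := opsub L L1) in *. set (eps := opnorm E) in *.
  assert (BE : BL E) by now apply BL_sub. assert (linE := proj1 BE).
  assert (Heps : 0 <= eps) by apply opnorm_ge0, BE.
  assert (He1 : g * eps * (10 * t + 3) <= 1).
  { apply Rle_trans with (r1 * (g * (10 * t + 3))); [|right; apply Rinv_l; lra].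
    replace (g * eps * (10 * t + 3)) with (eps * (g * (10 * t + 3))) by ring.
    apply Rmult_le_compat_r; lra. }
  assert (He2 : g * eps * (2 * y) <= delta).
  { apply Rle_trans with (r2 * (g * (2 * y))).
    - replace (g * eps * (2 * y)) with (eps * (g * (2 * y))) by ring.
      apply Rmult_le_compat_r; lra.
    - right. unfold r2. field. split; lra. }
  assert (Hge : 0 <= g * eps) by (apply Rmult_le_pos; lra).
  assert (HE : forall x, vnorm (E x) <= eps * vnorm x) by (intros; now apply opnorm_bound).
  destruct (eigen_perturb L1 lam1 u phi Sr p g eps L HD HL) as [v [phiL [SL' [Hv [Ev [HDL _]]]]]];
    trivial; try lra.
  { fold U. fold t. apply Rle_lt_trans with (g * eps * (6 * t)); [right; ring|]. nra. }
  fold E in Ev, HDL. set (w := vadd u v) in *. set (mu := phi (E w)) in *.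
  exists v, (kadd lam1 mu).
  assert (Hw : vnorm w <= y).
  { unfold w. eapply Rle_trans; [apply ax_norm_triangle|]. fold U. unfold y.
    apply Rplus_le_compat_l. apply Rmult_le_reg_l with p; [assumption|].
    replace (p * / (2 * p)) with (/ 2) by (field; lra). assumption. }
  assert (Hpw : p * vnorm w <= t + / 2).
  { apply Rle_trans with (p * y); [now apply Rmult_le_compat_l; [lra|]|].
    right. unfold y, t. field. lra. }
  split; [|split; [apply (ed_eigenvector _ _ _ _ _ HDL)|]].
  + rewrite Ev. eapply Rle_trans; [apply Hg|].
    apply Rle_trans with (g * (eps * (2 * y))); [|lra].
    apply Rmult_le_compat_l; [lra|].
    eapply Rle_trans; [apply vnorm_sub|]. rewrite ax_norm_scal.
    assert (H1 : kabs mu <= p * (eps * vnorm w)).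
    { eapply Rle_trans; [apply Hp|]. now apply Rmult_le_compat_l; [lra|]. }
    pose proof (HE w) as H2. pose proof (vnorm_ge0 v).
    assert (H3 : kabs mu * vnorm v <= eps * vnorm w * / 2).
    { apply Rle_trans with (eps * vnorm w * (p * vnorm v)).
      - replace (eps * vnorm w * (p * vnorm v)) with (p * (eps * vnorm w) * vnorm v) by ring.
        now apply Rmult_le_compat_r.
      - apply Rmult_le_compat_l; [|assumption]. apply Rmult_le_pos; [lra | apply vnorm_ge0]. }
    assert (eps * vnorm w <= eps * y) by now apply Rmult_le_compat_l.
    assert (0 <= eps * y) by (apply Rmult_le_pos; lra). lra.
  + set (x := fun i => wcoef u phi Sr i i (fun _ => E)).
    set (C := vnorm (vsub w u)).
    assert (Herr : forall N, vnorm (vsub w (vsum x N)) <= C * (/2) ^ N).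
    { apply (wcoef_sum_error u phi Sr Hf linS p g Hp Hg) with (eps := eps) (Rr := Rr);
        trivial; try lra.
      - unfold w at 1. f_equal. rewrite Ev at 1.
        replace (vsub (vscal (phi (E w)) w) (E w))
          with (vadd (vscal mu u) (vsub (vscal mu v) (E w))) by (unfold mu, w; vec).
        rewrite (lin_add Sr), (lin_scal Sr), Su by assumption. vec.
      - fold U. fold t. apply Rle_trans with (g * eps * (5 * t + 3 / 2)); [|lra].
        apply Rmult_le_compat_l; lra. }
    assert (Hsum : forall m, ksum (fun n => symmetrized n (a n) (fun _ => E)) (S m) =
                             kadd lam1 (phi (E (vsum x m)))).
    { assert (Ha : forall n, symmetrized n (a n) (fun _ => E) = a n (fun _ => E))
        by (intros n; apply (symmetrized_spec n (a n) (M n) (Hlin n) (Hbd n))).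
      induction m as [|m IH].
      - cbn [ksum]. now rewrite !Ha.
      - change (kadd (ksum (fun n => symmetrized n (a n) (fun _ => E)) (S m))
                     (symmetrized (S (S m)) (a (S (S m))) (fun _ => E)) =
                kadd lam1 (phi (E (vadd (vsum x m) (x (S m)))))).
        rewrite IH, Ha, (lin_add E), (form_add phi) by assumption.
        change (a (S (S m)) (fun _ => E)) with (phi (E (x (S m)))). ring. }
    intros e0 He0. destruct (pow_half_small (p * (eps * C)) e0 He0) as [N HN].
    exists (S N). intros [|m] Hm; [lia|].
    rewrite Hsum.
    replace (kadd (kadd lam1 (phi (E (vsum x m)))) (kopp (kadd lam1 mu)))
      with (kopp (phi (E (vsub w (vsum x m))))).
    2: { rewrite (lin_sub E), (form_sub phi) by assumption. fold mu. unfold ksub. ring. }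
    rewrite (kabs_opp HK). apply Rle_lt_trans with (p * (eps * C) * (/2) ^ m); [|apply HN; lia].
    eapply Rle_trans; [apply Hp|]. rewrite Rmult_assoc, (Rmult_assoc eps).
    apply Rmult_le_compat_l; [lra|]. eapply Rle_trans; [apply HE|].
    now apply Rmult_le_compat_l.
Qed.

Lemma eigen_data_analytic L0 lam0 u phi Sr p g :
  eigen_data L0 lam0 u phi Sr -> 0 <= g ->
  (forall x, kabs (phi x) <= p * vnorm x) -> (forall x, vnorm (Sr x) <= g * vnorm x) ->
  exists lam : (X -> X) -> K,
    analytic_on (fun L => 6 * (p * vnorm u) * g * opnorm (opsub L L0) < 1) lam /\
    lam L0 = lam0 /\
    (forall L, BL L -> 6 * (p * vnorm u) * g * opnorm (opsub L L0) < 1 ->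
       simple_isolated_eigenvalue L (lam L)).
Proof.
intros HD Hg0 Hp Hg.
assert (linphi := ed_form _ _ _ _ _ HD).
assert (Hpp : 0 < p).
{ pose proof (Hp u) as H. rewrite (ed_normalized _ _ _ _ _ HD), (kabs_1 HK) in H.
  pose proof (vnorm_ge0 u). nra. }
set (mu := fun L v => kadd lam0 (phi (opsub L L0 (vadd u v)))).
set (Q := fun L v => exists phiL SL,
  p * vnorm v <= / 2 /\ phi v = k0 /\ eigen_data L (mu L v) (vadd u v) phiL SL /\
  forall d, p * vnorm d <= 5 / 4 -> kabs (phi d) <= / 4 -> phiL (vadd (vadd u v) d) <> k0).
set (v := fun L => epsilon (inhabits vzero) (Q L)).
assert (HQ : forall L, BL L -> 6 * (p * vnorm u) * g * opnorm (opsub L L0) < 1 -> Q L (v L)).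
{ intros L HL Hs. apply epsilon_spec.
  assert (BE : BL (opsub L L0)) by (apply BL_sub; [assumption | apply HD]).
  destruct (eigen_perturb L0 lam0 u phi Sr p g (opnorm (opsub L L0)) L HD HL)
    as [v0 [phiL [SL [Hv [Ev [HDL HU]]]]]]; trivial.
  - apply opnorm_ge0, BE.
  - intros x. now apply opnorm_bound.
  - exists v0, phiL, SL. split; [assumption|]. split; [|split; assumption].
    rewrite Ev. apply (ed_form_res _ _ _ _ _ HD). }
exists (fun L => mu L (v L)). split; [|split].
- intros L1 HL1 Hs1. destruct (HQ L1 HL1 Hs1) as [phi1 [S1 [Hv1 [fv1 [HD1 _]]]]].
  assert (Hdelta : 0 < / (4 * p)) by (apply Rinv_0_lt_compat; lra).
  destruct (eigen_local_series _ _ _ _ _ _ HD1 Hdelta)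
    as [A [M [r [Hr [HA [Hbd [Hcv Hser]]]]]]].
  exists A, M, r. repeat (split; [assumption|]).
  intros L HL Hs Hlt. destruct (Hser L HL Hlt) as [x [lam [Hx [Lx Hconv]]]].
  destruct (HQ L HL Hs) as [phiL [SL [HvL [fvL [HDL HU]]]]].
  replace (mu L (v L)) with lam; [assumption|].
  (* [phiL] does not vanish on the eigenvector [u + v L1 + x], so both eigenvalues agree *)
  set (z := vadd (vadd u (v L1)) x) in *.
  assert (Hpx : p * vnorm x <= / 4).
  { apply Rle_trans with (p * / (4 * p)); [apply Rmult_le_compat_l; lra|].
    right. field. lra. }
  assert (Hz : phiL z <> k0).
  { replace z with (vadd (vadd u (v L)) (vadd (vsub (v L1) (v L)) x)) by (unfold z; vec).
    apply HU.
    - pose proof (ax_norm_triangle _ (vsub (v L1) (v L)) x) as H1.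
      pose proof (vnorm_sub (v L1) (v L)) as H2.
      apply Rle_trans with (p * (vnorm (v L1) + vnorm (v L) + vnorm x)); [|lra].
      apply Rmult_le_compat_l; lra.
    - rewrite (form_add phi), (form_sub phi), fv1, fvL by assumption.
      replace (kadd (ksub k0 k0) (phi x)) with (phi x) by (unfold ksub; ring).
      pose proof (Hp x). lra. }
  pose proof (ed_eigenform _ _ _ _ _ HDL z) as E1.
  rewrite Lx, (form_scal phiL) in E1 by apply HDL.
  destruct (kmul_integral HK (ksub lam (mu L (v L))) (phiL z)) as [E2 | E2]; [|  |contradiction].
  + replace (kmul (ksub lam (mu L (v L))) (phiL z))
      with (ksub (kmul lam (phiL z)) (kmul (mu L (v L)) (phiL z))) by (unfold ksub; ring).
    rewrite E1. unfold ksub. ring.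
  + replace lam with (kadd (ksub lam (mu L (v L))) (mu L (v L))) by (unfold ksub; ring).
    rewrite E2. ring.
- unfold mu. replace (opsub L0 L0 (vadd u (v L0))) with (@vzero K X) by (unfold opsub; vec).
  rewrite (form_0 phi) by assumption. ring.
- intros L HL Hs. destruct (HQ L HL Hs) as [phiL [SL [_ [_ [HDL _]]]]].
  exact (eigen_data_SIE _ _ _ _ _ HDL).
Qed.

Lemma Pop_BL (phi : X -> K) (u : X) :
  is_linear_form phi -> is_bounded_form phi -> BL (Pop phi u).
Proof.
intros Hf [C HC]. split; [split|].
- intros x y. unfold Pop. rewrite (form_add phi) by assumption. vec.
- intros a x. unfold Pop. rewrite (form_scal phi) by assumption. vec.
- exists (C * vnorm u). intros x. unfold Pop. rewrite ax_norm_scal.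
  pose proof (HC x). pose proof (vnorm_ge0 u). nra.
Qed.

End Space.

Theorem theoremA (K : Scalars) (HK : K = RK \/ K = CK) (X : Banach K)
  (L0 : X -> X) (lam0 : K) (u : X) (G : X -> Prop) (Rinv : X -> X) (phi : X -> K) :
  BL L0 ->
  SIE_data L0 lam0 u G Rinv ->
  is_linear_form phi -> is_bounded_form phi ->
  (forall x, phi (L0 x) = kmul lam0 (phi x)) ->
  (forall x, phi x = k0 <-> G x) ->
  phi u = k1 ->
  let tau0 := opnorm (Pop phi u) in
  let gamma0 := opnorm (Sop phi u Rinv) in
  exists lam : (X -> X) -> K,
    analytic_on (fun L => 6 * tau0 * gamma0 * opnorm (opsub L L0) < 1) lam /\
    lam L0 = lam0 /\
    (forall L, BL L -> 6 * tau0 * gamma0 * opnorm (opsub L L0) < 1 ->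
       simple_isolated_eigenvalue L (lam L)).
Proof.
intros HL HS Hf Bf fL fG fu tau0 gamma0.
pose proof (SIE_eigen_data HK L0 lam0 u G Rinv phi HL HS Hf Bf fL fG fu) as HD.
assert (Hu : 0 < vnorm u) by (apply (vnorm_pos HK), HS).
assert (BP := Pop_BL HK phi u Hf Bf). assert (BS := ed_res _ _ _ _ _ HD).
replace tau0 with (tau0 / vnorm u * vnorm u) by (field; lra).
apply (eigen_data_analytic HK) with (phi := phi) (Sr := Sop phi u Rinv).
- assumption.
- now apply (opnorm_ge0 HK), BS.
- intros x. apply Rmult_le_reg_r with (vnorm u); [assumption|].
  replace (tau0 / vnorm u * vnorm x * vnorm u) with (tau0 * vnorm x) by (field; lra).
  rewrite <- ax_norm_scal. exact (opnorm_bound HK (Pop phi u) x BP).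
- intros x. now apply (opnorm_bound HK).
Qed.
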